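(* Let $M$ and $N$ be $kQ$-modules, with dimension vectors $\underline m,\underline n\in\mathbb Z^n_{\ge 0}$. Then $$q^{[M,N]^{1}}X_{N}X_{M}=q^{-\frac{1}{2}\Lambda((\widetilde{I}-\widetilde{R})\underline{m},\,(\widetilde{I}-\widetilde{R})\underline{n})}\sum_{E}\varepsilon_{MN}^{E}X_E ,$$ where $E$ runs over the isomorphism classes of $kQ$-modules.
   Context: Let $k$ be a finite field with $|k|=q$ (with a fixed square root $q^{1/2}$), let $m\ge n$ be positive integers, and let $\widetilde Q$ be an acyclic quiver with vertex set $\{1,\dots,m\}$; the vertices $n+1,\dots,m$ are called frozen, and $Q$ is the full subquiver on $\{1,\dots,n\}$. Modules are finite-dimensional, with the convention that $\dim_k\mathrm{Ext}^1_{k\widetilde Q}(S_i,S_j)$ is the number of arrows $j\to i$, where $S_i$ is the simple module at $i$. A $kQ$-module is viewed as a $k\widetilde Q$-module supported on $\{1,\dots,n\}$, and its dimension vector is regarded as a column vector in $\mathbb Z^n$. Matrices ($m\times n$): $\widetilde B=(b_{ij})$ with $b_{ij}=\#\{i\to j\}-\#\{j\to i\}$; $\widetilde R=(\widetilde r_{ij})$ with $\widetilde r_{ij}=\dim_k\mathrm{Ext}^1_{k\widetilde Q}(S_i,S_j)$; $\widetilde I=\begin{bmatrix}I_n\\0\end{bmatrix}$. It is assumed that there is an antisymmetric integer $m\times m$ matrix $\Lambda$ with $\Lambda(-\widetilde B)=\widetilde I$, and such a $\Lambda$ is fixed; write $\Lambda(a,b)=a^{tr}\Lambda b$ for $a,b\in\mathbb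 Z^m$. $\mathcal T$ is the $\mathbb Z[q^{\pm1/2}]$-algebra with basis $\{X^e: e\in\mathbb Z^m\}$ and multiplication $X^eX^f=q^{\Lambda(e,f)/2}X^{e+f}$. $[M,N]=\dim_k\mathrm{Hom}(M,N)$, $[M,N]^1=\dim_k\mathrm{Ext}^1(M,N)$, and $\langle M,N\rangle=[M,N]-[M,N]^1$ is the Euler form, which depends only on dimension vectors and extends bilinearly to them. Quantum Caldero-Chapoton map: for a $kQ$-module $M$ with dimension vector $\underline m$, $$X_M=\sum_{\underline e}|\mathrm{Gr}_{\underline e}M|\,q^{-\frac12\langle\underline e,\underline m-\underline e\rangle}X^{\widetilde B\underline e-(\widetilde I-\widetilde R)\underline m}\in\mathcal T,$$ where $\mathrm{Gr}_{\underline e}M$ is the set of submodules of $M$ of dimension vector $\underline e$. $\varepsilon_{MN}^{E}$ is the cardinality of $\mathrm{Ext}^1_{kQ}(M,N)_E$, the subset of $\mathrm{Ext}^1_{kQ}(M,N)$ of equivalence classes of short exact sequences $0\to N\to L\to M\to 0$ with middle term $L\cong E$. *)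

(* Defs.v *)
From HB Require Import structures.
From mathcomp Require Import all_boot all_order all_algebra all_field.
From mathcomp Require Import finmap monalg.
From mathcomp Require Import boolp classical_sets cardinality fsbigop.

Set Implicit Arguments.
Unset Strict Implicit.
Unset Printing Implicit Defensive.

Import GRing.Theory Num.Theory.

Local Open Scope classical_set_scope.
Local Open Scope ring_scope.

Record quiver (V : finType) := Quiver {
  arrow : finType;
  src : arrow -> V;
  tgt : arrow -> V }.

Definition arrows_between (V : finType) (Q : quiver V) (i j : V) :
    {set arrow Q} :=
  [set a | (src a == i) && (tgt a == j)].

Definition adjacent (V : finType) (Q : quiver V) : rel V :=
  fun i j => [exists a : arrow Q, (src a == i) && (tgt a == j)].

(* [cycle e s] holds trivially for [s = [::]] and says, for nonempty [s], that
   consecutive elements (cyclically) are joined by an arrow. *)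
Definition acyclic (V : finType) (Q : quiver V) : Prop :=
  forall s : seq V, cycle (@adjacent V Q) s -> s = [::].

Section FullSubquiver.
Variables (m n : nat) (Q : quiver 'I_m).

Definition sub_arrow : finType :=
  {a : arrow Q | ((src a < n) && (tgt a < n))%N}.

Definition sub_src (a : sub_arrow) : 'I_n :=
  Ordinal (proj1 (andP (valP a))).

Definition sub_tgt (a : sub_arrow) : 'I_n :=
  Ordinal (proj2 (andP (valP a))).

Definition full_subquiver : quiver 'I_n := Quiver sub_src sub_tgt.
End FullSubquiver.

(* The structure of a module over the path algebra of [Q] on the vector space
   [U], given by the action of the generators (trivial paths and arrows) subject
   to the defining relations. The convention
   dim Ext^1(S_i, S_j) = #{arrows j -> i} forces an arrow [a : s -> t] to map
   the component at [t] to the component at [s]. *)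
Record qmod_on (k : fieldType) (V : finType) (Q : quiver V) (U : vectType k) :=
  QModOn {
    act_idem : V -> 'End(U);
    act_arr : arrow Q -> 'End(U);
    act_orth : forall i j : V,
      (act_idem i \o act_idem j)%VF = if i == j then act_idem i else 0;
    act_sum : \sum_i act_idem i = \1%VF;
    act_arr_idem : forall a : arrow Q,
      (act_idem (src a) \o act_arr a \o act_idem (tgt a))%VF = act_arr a }.

Record qmod (k : fieldType) (V : finType) (Q : quiver V) := QMod {
  qmod_space :> vectType k;
  qmod_str : qmod_on Q qmod_space }.

Definition idem (k : fieldType) (V : finType) (Q : quiver V) (M : qmod k Q) :
  V -> 'End(M) := act_idem (qmod_str M).

Definition arr (k : fieldType) (V : finType) (Q : quiver V) (M : qmod k Q) :
  arrow Q -> 'End(M) := act_arr (qmod_str M).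

Section Modules.
Variables (k : fieldType) (V : finType) (Q : quiver V).
Local Notation qmod := (qmod k Q).
Implicit Types L M N E : qmod.

Lemma idem_orth M i j : (idem M i \o idem M j)%VF = if i == j then idem M i else 0.
Proof. exact: act_orth. Qed.

Lemma idem_sum M : \sum_i idem M i = \1%VF.
Proof. exact: act_sum. Qed.

Lemma arr_idem M a :
  (idem M (src a) \o arr M a \o idem M (tgt a))%VF = arr M a.
Proof. exact: act_arr_idem. Qed.

Definition is_hom M N (f : 'Hom(M, N)) : Prop :=
  (forall i, (f \o idem M i)%VF = (idem N i \o f)%VF) /\
  (forall a, (f \o arr M a)%VF = (arr N a \o f)%VF).

Definition isomorphic M N : Prop :=
  exists (f : 'Hom(M, N)) (g : 'Hom(N, M)),
    [/\ is_hom f, is_hom g, (g \o f)%VF = \1%VF & (f \o g)%VF = \1%VF].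

Definition commutator M N (x : 'End(M)) (y : 'End(N)) (f : 'Hom(M, N)) :
    'Hom(M, N) :=
  (f \o x)%VF - (y \o f)%VF.

Fact commutator_linear M N x y : linear (@commutator M N x y).
Proof.
move=> c f g; rewrite /commutator comp_lfunDl comp_lfunDr -comp_lfunZl -comp_lfunZr.
by rewrite scalerBr opprD addrACA.
Qed.

HB.instance Definition _ M N x y :=
  GRing.isLinear.Build k 'Hom(M, N) 'Hom(M, N) _ (@commutator M N x y)
    (@commutator_linear M N x y).

Definition hom_space M N : {vspace 'Hom(M, N)} :=
  ((\bigcap_i lker (linfun (commutator (idem M i) (idem N i)))) :&:
   (\bigcap_a lker (linfun (commutator (arr M a) (arr N a)))))%VS.

Lemma hom_spaceP M N (f : 'Hom(M, N)) : f \in hom_space M N <-> is_hom f.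
Proof.
have comE x y : (f \in lker (linfun (@commutator M N x y))) =
    ((f \o x)%VF == (y \o f)%VF).
  by rewrite memv_ker lfunE /= subr_eq0.
rewrite memv_cap !memvE; split.
  case/andP=> /subv_bigcapP h1 /subv_bigcapP h2; split=> [i|a]; apply/eqP.
    by rewrite -comE memvE h1.
  by rewrite -comE memvE h2.
case=> h1 h2; apply/andP; split; apply/subv_bigcapP => x _.
  by rewrite -memvE comE h1.
by rewrite -memvE comE h2.
Qed.

Definition hom_dim M N : nat := \dim (hom_space M N).

Definition is_submod M (U : {vspace M}) : Prop :=
  (forall i, (idem M i @: U <= U)%VS) /\ (forall a, (arr M a @: U <= U)%VS).

Definition pairf (U1 U2 W1 W2 : vectType k) (f : 'Hom(U1, W1))
    (g : 'Hom(U2, W2)) (x : U1 * U2) : W1 * W2 :=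
  (f x.1, g x.2).

Fact pairf_linear (U1 U2 W1 W2 : vectType k) (f : 'Hom(U1, W1))
    (g : 'Hom(U2, W2)) : linear (@pairf U1 U2 W1 W2 f g).
Proof. by move=> c x y; rewrite /pairf /= !linearP. Qed.

HB.instance Definition _ (U1 U2 W1 W2 : vectType k) (f : 'Hom(U1, W1))
    (g : 'Hom(U2, W2)) :=
  GRing.isLinear.Build k (U1 * U2)%type (W1 * W2)%type _ (@pairf U1 U2 W1 W2 f g)
    (@pairf_linear U1 U2 W1 W2 f g).

Definition dsum_lfun (U1 U2 W1 W2 : vectType k) (f : 'Hom(U1, W1))
    (g : 'Hom(U2, W2)) : 'Hom((U1 * U2)%type, (W1 * W2)%type) :=
  linfun (pairf f g).

Lemma dsum_lfunE (U1 U2 W1 W2 : vectType k) (f : 'Hom(U1, W1))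
    (g : 'Hom(U2, W2)) x : dsum_lfun f g x = (f x.1, g x.2).
Proof. by rewrite lfunE. Qed.

Section DirectSum.
Variables M N : qmod.

Fact dsum_idem_orth i j :
  (dsum_lfun (idem M i) (idem N i) \o dsum_lfun (idem M j) (idem N j))%VF =
  if i == j then dsum_lfun (idem M i) (idem N i) else 0.
Proof.
apply/lfunP => x; rewrite comp_lfunE !dsum_lfunE /= -!comp_lfunE !idem_orth.
by case: eqP => _; rewrite ?dsum_lfunE // !zero_lfunE.
Qed.

Fact dsum_idem_sum : \sum_i dsum_lfun (idem M i) (idem N i) = \1%VF.
Proof.
apply/lfunP => x; rewrite sum_lfunE id_lfunE.
under eq_bigr do rewrite dsum_lfunE.
have hM : \sum_i idem M i x.1 = x.1 by rewrite -sum_lfunE idem_sum id_lfunE.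
have hN : \sum_i idem N i x.2 = x.2 by rewrite -sum_lfunE idem_sum id_lfunE.
rewrite [RHS]surjective_pairing -[in RHS]hM -[in RHS]hN.
by elim/big_ind3: _ => // a1 a2 a3 b1 b2 b3 -> ->.
Qed.

Fact dsum_arr_idem a :
  (dsum_lfun (idem M (src a)) (idem N (src a)) \o
     dsum_lfun (arr M a) (arr N a) \o
     dsum_lfun (idem M (tgt a)) (idem N (tgt a)))%VF =
  dsum_lfun (arr M a) (arr N a).
Proof.
apply/lfunP => x; rewrite !comp_lfunE !dsum_lfunE /=.
by rewrite -[in RHS](arr_idem M a) -[in RHS](arr_idem N a) !comp_lfunE.
Qed.

Definition dsum : qmod :=
  QMod (QModOn dsum_idem_orth dsum_idem_sum dsum_arr_idem).
End DirectSum.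

Record ses M N := SES {
  mid : qmod;
  ses_in : 'Hom(N, mid);
  ses_out : 'Hom(mid, M);
  ses_in_hom : is_hom ses_in;
  ses_out_hom : is_hom ses_out;
  ses_inj : lker ses_in = 0%VS;
  ses_exact : limg ses_in = lker ses_out;
  ses_surj : limg ses_out = fullv }.

Arguments ses : clear implicits.

(* [ses_mor alpha beta xi zeta]: there is a morphism of short exact sequences
   from [xi] to [zeta] with outer components [alpha] and [beta]. *)
Definition ses_mor M N M' N' (alpha : 'Hom(N, N')) (beta : 'Hom(M, M'))
    (xi : ses M N) (zeta : ses M' N') : Prop :=
  exists phi : 'Hom(mid xi, mid zeta),
    [/\ is_hom phi,
        (phi \o ses_in xi)%VF = (ses_in zeta \o alpha)%VF &
        (ses_out zeta \o phi)%VF = (beta \o ses_out xi)%VF].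

Definition ses_equiv M N (xi zeta : ses M N) : Prop := ses_mor \1%VF \1%VF xi zeta.

(* [d] is the number of equivalence classes of short exact sequences
   0 -> N -> L -> M -> 0 with L isomorphic to E: there is a complete irredundant
   system of representatives indexed by ['I_d]. *)
Definition is_eps M N E (d : nat) : Prop :=
  exists phi : 'I_d -> ses M N,
    [/\ forall i, isomorphic (mid (phi i)) E,
        forall i j, ses_equiv (phi i) (phi j) -> i = j &
        forall xi, isomorphic (mid xi) E -> exists i, ses_equiv (phi i) xi].

Definition eps M N E : nat := xget 0%N [set d | is_eps M N E d].

Section SesDirectSum.
Variables (M N M' N' : qmod) (xi : ses M N) (zeta : ses M' N').

Fact dsum_hom (A B A' B' : qmod) (f : 'Hom(A, B)) (g : 'Hom(A', B')) :
  is_hom f -> is_hom g ->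
  @is_hom (dsum A A') (dsum B B') (dsum_lfun f g).
Proof.
move=> [fi fa] [gi ga]; split=> [i|a]; apply/lfunP => x;
  rewrite !comp_lfunE /= !dsum_lfunE /= -!comp_lfunE.
  by rewrite fi gi.
by rewrite fa ga.
Qed.

Fact dsum_inj : lker (dsum_lfun (ses_in xi) (ses_in zeta)) = 0%VS.
Proof.
apply/eqP/lker0P => -[x1 x2] [y1 y2]; rewrite !dsum_lfunE /= => -[e1 e2].
have /eqP/lker0P i1 := ses_inj xi; have /eqP/lker0P i2 := ses_inj zeta.
by rewrite (i1 _ _ e1) (i2 _ _ e2).
Qed.

Fact dsum_exact : limg (dsum_lfun (ses_in xi) (ses_in zeta)) =
                  lker (dsum_lfun (ses_out xi) (ses_out zeta)).
Proof.
apply/vspaceP => -[x1 x2]; rewrite memv_ker dsum_lfunE /=.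
apply/memv_imgP/eqP => [[[u1 u2] _]|[e1 e2]].
  rewrite dsum_lfunE /= => -[-> ->]; congr pair; apply/eqP; rewrite -memv_ker.
    by rewrite -ses_exact memv_img ?memvf.
  by rewrite -ses_exact memv_img ?memvf.
have /memv_imgP[u1 _ ->] : x1 \in limg (ses_in xi).
  by rewrite ses_exact memv_ker e1.
have /memv_imgP[u2 _ ->] : x2 \in limg (ses_in zeta).
  by rewrite ses_exact memv_ker e2.
by exists (u1, u2); rewrite ?memvf // dsum_lfunE.
Qed.

Fact dsum_surj : limg (dsum_lfun (ses_out xi) (ses_out zeta)) = fullv.
Proof.
apply/vspaceP => -[x1 x2]; rewrite memvf; apply/memv_imgP.
have /memv_imgP[u1 _ ->] : x1 \in limg (ses_out xi) by rewrite ses_surj memvf.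
have /memv_imgP[u2 _ ->] : x2 \in limg (ses_out zeta) by rewrite ses_surj memvf.
by exists (u1, u2); rewrite ?memvf // dsum_lfunE.
Qed.

Definition ses_dsum : ses (dsum M M') (dsum N N') :=
  @SES (dsum M M') (dsum N N') (dsum (mid xi) (mid zeta))
    (dsum_lfun (ses_in xi) (ses_in zeta))
    (dsum_lfun (ses_out xi) (ses_out zeta))
    (dsum_hom (ses_in_hom xi) (ses_in_hom zeta))
    (dsum_hom (ses_out_hom xi) (ses_out_hom zeta))
    dsum_inj dsum_exact dsum_surj.
End SesDirectSum.

Definition diag_lfun M : 'Hom(M, dsum M M) :=
  linfun (fun x : M => (x, x) : dsum M M).

Lemma diag_lfunE M x : diag_lfun M x = (x, x).
Proof.
pose f (y : M) : dsum M M := (y, y).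
have flin : linear f by [].
pose F : {linear M -> dsum M M} :=
  HB.pack f (GRing.isLinear.Build k M (dsum M M) _ f flin).
exact: (lfunE F).
Qed.

Definition codiag_lfun N : 'Hom(dsum N N, N) :=
  linfun (fun x : dsum N N => (x.1 + x.2 : N)).

Lemma codiag_lfunE N x : codiag_lfun N x = x.1 + x.2.
Proof.
pose f (y : dsum N N) : N := y.1 + y.2.
have flin : linear f by move=> c y z; rewrite /f /= scalerDr addrACA.
pose F : {linear dsum N N -> N} :=
  HB.pack f (GRing.isLinear.Build k (dsum N N) N _ f flin).
exact: (lfunE F).
Qed.

(* Baer sum: the class of [xi3] is the pushout along the codiagonal of the
   pullback [zeta] along the diagonal of the direct sum of [xi1] and [xi2]. *)
Definition is_baer_sum M N (xi1 xi2 xi3 : ses M N) : Prop :=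
  exists zeta : ses M (dsum N N),
    ses_mor \1%VF (diag_lfun M) zeta (ses_dsum xi1 xi2) /\
    ses_mor (codiag_lfun N) \1%VF zeta xi3.

(* The class of [zeta] is the pushout of [xi] along multiplication by [c]. *)
Definition is_scaling M N (c : k) (xi zeta : ses M N) : Prop :=
  ses_mor (c *: \1%VF) \1%VF xi zeta.

(* [d] is the dimension of the k-vector space of equivalence classes of short
   exact sequences: k^d is linearly isomorphic to it via [u |-> class (phi u)]. *)
Definition is_ext1_dim M N (d : nat) : Prop :=
  exists phi : 'rV[k]_d -> ses M N,
    [/\ forall u w, ses_equiv (phi u) (phi w) -> u = w,
        forall xi, exists u, ses_equiv (phi u) xi,
        forall u w, is_baer_sum (phi u) (phi w) (phi (u + w)) &
        forall c u, is_scaling c (phi u) (phi (c *: u))].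

Definition ext1_dim M N : nat := xget 0%N [set d | is_ext1_dim M N d].

Definition euler M N : int := (hom_dim M N)%:Z - (ext1_dim M N)%:Z.

Section Simple.
Variable i0 : V.

Let e (i : V) : 'End(k^o) := if i == i0 then \1%VF else 0.

Fact simple_idem_orth i j : (e i \o e j)%VF = if i == j then e i else 0.
Proof.
rewrite /e; case: (eqVneq i j) => [<-|ij].
  by case: eqP => _; rewrite ?comp_lfun0r ?comp_lfun1l.
case: (eqVneq i i0) ij => [->|_ _]; last by rewrite comp_lfun0l.
by rewrite eq_sym => /negPf->; rewrite comp_lfun0r.
Qed.

Fact simple_idem_sum : \sum_i e i = \1%VF.
Proof. by rewrite /e -big_mkcond big_pred1_eq. Qed.

Fact simple_arr_idem (a : arrow Q) :
  (e (src a) \o (0 : 'End(k^o)) \o e (tgt a))%VF = 0.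
Proof. by rewrite comp_lfun0r comp_lfun0l. Qed.

Definition simple : qmod :=
  QMod (@QModOn k V Q k^o e (fun=> 0)
          simple_idem_orth simple_idem_sum simple_arr_idem).
End Simple.

(* All modules form a type too large for [set], so isomorphism classes are
   indexed by chosen representatives among the modules whose underlying space is
   some k^d; every class has one by [std_modP]. *)
Definition std_mod : Type := {classic {d : nat & qmod_on Q 'rV[k]_d}}.

Definition std_qmod (E : std_mod) : qmod := QMod (projT2 E).

Section StdMod.
Import passmx.

Lemma std_modP M : exists E : std_mod, isomorphic M (std_qmod E).
Proof.
pose e := vbasis {:M}; have eb : basis_of {:M} e by apply: vbasisP.
pose f : 'Hom(M, 'rV[k]_(\dim {:M})) := linfun (rVof e).
pose g : 'Hom('rV[k]_(\dim {:M}), M) := linfun (vecof e).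
have fK : (g \o f)%VF = \1%VF.
  by apply/lfunP => x; rewrite id_lfunE comp_lfunE 2!lfunE /= rVofK.
have gK : (f \o g)%VF = \1%VF.
  by apply/lfunP => x; rewrite id_lfunE comp_lfunE 2!lfunE /= vecofK.
have fKx x : g (f x) = x by rewrite -comp_lfunE fK id_lfunE.
pose conj (x : 'End(M)) := (f \o x \o g)%VF.
have conjM x y : (conj x \o conj y)%VF = conj (x \o y)%VF.
  by apply/lfunP => u; rewrite /conj !comp_lfunE fKx.
have orth i j : (conj (idem M i) \o conj (idem M j))%VF =
    if i == j then conj (idem M i) else 0.
  rewrite conjM idem_orth; case: eqP => // _.
  by rewrite /conj comp_lfun0r comp_lfun0l.
have total : \sum_i conj (idem M i) = \1%VF.
  apply/lfunP => x; rewrite sum_lfunE id_lfunE -[RHS](id_lfunE x) -gK.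
  rewrite comp_lfunE -[g x in RHS](id_lfunE (g x)) -(idem_sum M) sum_lfunE.
  by rewrite linear_sum; apply: eq_bigr => i _; rewrite !comp_lfunE.
have arrE a : (conj (idem M (src a)) \o conj (arr M a) \o
    conj (idem M (tgt a)))%VF = conj (arr M a).
  by rewrite !conjM arr_idem.
exists (existT (fun d => qmod_on Q 'rV[k]_d) _ (QModOn orth total arrE)).
have conjf x : (f \o x)%VF = (conj x \o f)%VF.
  by apply/lfunP => u; rewrite /conj !comp_lfunE fKx.
have conjg x : (g \o conj x)%VF = (x \o g)%VF.
  by apply/lfunP => u; rewrite /conj !comp_lfunE fKx.
by exists f, g; split=> //; split=> ?; rewrite ?conjf ?conjg.
Qed.

End StdMod.

(* [iso_repr] depends only on the isomorphism class of its argument. *)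
Definition iso_repr (E : std_mod) : std_mod :=
  xget E [set F | isomorphic (std_qmod E) (std_qmod F)].

Definition iso_classes : set std_mod := range iso_repr.

End Modules.

Section DimensionVectors.
Variables (k : fieldType) (n : nat) (Q : quiver 'I_n).
Local Notation qmod := (qmod k Q).

Definition sub_dimvec (M : qmod) (U : {vspace M}) : 'cV[int]_n :=
  \col_i (\dim (idem M i @: U))%:Z.

Definition dimvec (M : qmod) : 'cV[int]_n := sub_dimvec (fullv : {vspace M}).

(* The bilinear extension of the Euler form to Z^n: the dimension vectors of
   the simple modules form the standard basis. *)
Definition euler_form (e f : 'cV[int]_n) : int :=
  \sum_i \sum_j e i 0 * f j 0 * euler (simple k Q i) (simple k Q j).

Definition Gr (e : 'cV[int]_n) (M : qmod) : set {vspace M} :=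
  [set U | is_submod U /\ sub_dimvec U = e].
End DimensionVectors.

Arguments Gr {k n Q} e M.

Section HalfIntegers.
(* [v] plays the role of the fixed square root of [q]. *)
Variable v : algC.

(* The subring of the complex numbers generated by [v] and its inverse. *)
Definition Zv_pred : {pred algC} := fun x : algC =>
  `[< forall S : {pred algC}, subring_closed S -> v \in S -> v^-1 \in S ->
      x \in S >].

Fact Zv_subring : subring_closed Zv_pred.
Proof.
split=> [|x y /asboolP hx /asboolP hy|x y /asboolP hx /asboolP hy];
  apply/asboolP => S hS vS wS.
- by case: hS.
- by case: (hS) => _ hB _; apply: hB; [apply: hx|apply: hy].
- by case: (hS) => _ _ hM; apply: hM; [apply: hx|apply: hy].
Qed.

HB.instance Definition _ := GRing.isSubringClosed.Build algC Zv_pred Zv_subring.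

Record Zv := MkZv { Zv_val :> algC; Zv_valP : Zv_val \in Zv_pred }.

HB.instance Definition _ := [isSub for Zv_val].
HB.instance Definition _ := [Choice of Zv by <:].
HB.instance Definition _ := [SubChoice_isSubComNzRing of Zv by <:].

Fact vpow_subproof (z : int) : v ^ z \in Zv_pred.
Proof.
apply/asboolP => S hS vS wS.
have powS x p : x \in S -> x ^+ p \in S.
  case: (hS) => h1 _ hM xS; elim: p => [|p IH]; first by rewrite expr0.
  by rewrite exprS hM.
by case: z => p; rewrite ?NegzE -?exprz_inv; apply: powS.
Qed.

(* [vpow z] is q^{z/2}. *)
Definition vpow (z : int) : Zv := MkZv (vpow_subproof z).
End HalfIntegers.

Section QuantumTorus.
Variables (v : algC) (m : nat) (Lam : 'M[int]_m).

Definition lam_form (a b : 'cV[int]_m) : int := (a^T *m Lam *m b) 0 0.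

(* The free Z[q^{1/2}, q^{-1/2}]-module with basis X^e = << e >>. *)
Definition torus := {malg (Zv v)['cV[int]_m]}.

(* The bilinear multiplication with X^e X^f = q^{Lam(e, f)/2} X^{e + f}. *)
Definition torus_mul (x y : torus) : torus :=
  \sum_(e <- msupp x) \sum_(f <- msupp y)
    (x@_e * y@_f * vpow v (lam_form e f)) *: << e + f >>.

Lemma torus_mulX (e f : 'cV[int]_m) :
  torus_mul << e >> << f >> = vpow v (lam_form e f) *: << e + f >>.
Proof.
rewrite /torus_mul !msuppU oner_eq0 !big_seq_fset1.
by rewrite !mcoeffU !eqxx !mulr1n !mul1r.
Qed.
End QuantumTorus.

Section CalderoChapoton.
Variables (k : finFieldType) (m n : nat) (le_nm : (n <= m)%N).
Variable Qt : quiver 'I_m.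

Local Notation widen := (widen_ord le_nm).

Definition Btilde : 'M[int]_(m, n) :=
  \matrix_(i, j) (#|arrows_between Qt i (widen j)|%:Z -
                  #|arrows_between Qt (widen j) i|%:Z).

Definition Rtilde : 'M[int]_(m, n) :=
  \matrix_(i, j) (ext1_dim (simple k Qt i) (simple k Qt (widen j)))%:Z.

Definition Itilde : 'M[int]_(m, n) := pid_mx n.

Definition X_CC (v : algC) (M : qmod k (full_subquiver n Qt)) :
    torus v m :=
  \sum_(e \in [set: 'cV[int]_n])
    ((#|` fset_set (Gr e M)|)%:R *
       vpow v (- euler_form k (full_subquiver n Qt) e (dimvec M - e))) *:
    << Btilde *m e - (Itilde - Rtilde) *m dimvec M >>.
End CalderoChapoton.

(* Main.v *)
From HB Require Import structures.
Require Import Defs.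
From mathcomp Require Import all_boot all_order all_algebra all_field.
From mathcomp Require Import finmap monalg.
From mathcomp Require Import boolp classical_sets cardinality fsbigop.
From mathcomp Require Import ring.

Set Implicit Arguments.
Unset Strict Implicit.
Unset Printing Implicit Defensive.

Import GRing.Theory Num.Theory.
Local Open Scope ring_scope.

(** The identity counts submodules of extensions in two ways.

    An extension of M by N is equivalent to one on the space N + M in which an
    arrow a from s to t acts by (x, y) |-> (a x + xi_a y, a y), for a cochain
    xi: a family of maps xi_a from M_t to N_s ([ses_twist]). Two cochains give
    equivalent extensions exactly when they differ by a coboundary h a - a h,
    for a family h of maps from M_i to N_i ([twist_equivP]). So Ext^1(M, N) is
    the cokernel and Hom(M, N) the kernel of one linear map [delta], and the
    Euler form is a difference of two explicit dimensions ([eulerE],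
    [euler_formE]).

    Summing over all cochains rather than over one cochain in each class
    multiplies the right-hand side by the number of coboundaries
    ([sum_iso_classes], [X_CC_cohomologous]), and turns it into a sum over
    pairs of a cochain xi and a submodule W of the extension given by xi. Such
    a W has a trace T on N and an image U in M, and its dimension vector is the
    sum of those of T and U. Conversely, fix T and U. A graded subspace with
    trace T and image U is the graph of a graded map h from U to N / T, and it
    is a submodule for xi exactly when the cochain from U to N / T induced by xi
    is the coboundary of h ([graph_sub_submod]). Hence h is arbitrary and, given
    h, the cochain xi runs through a coset of the kernel of the restriction from
    cochains on (M, N) onto cochains on (U, N / T). The number of pairs is
    therefore q to the power (dimension of the space of cochains on (M, N)) +
    <U, N / T> ([card_over], [card_over_euler]). Cochains split into classes and
    coboundaries, so this exponent is [M, N]^1 + <U, N / T> once the factor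
    counting coboundaries is cancelled.

    What is left is a comparison of powers of the square root of q, term by term
    in T and U. If E denotes the matrix of the Euler form, the top square block
    of the exchange matrix is E - E^tr; with the compatibility of Lambda, this
    rewrites the exponent produced by the quantum torus in terms of Euler forms
    ([exponent_identity]).

    The modules U and N / T enter through graded idempotents r of M with image U
    and p of N with kernel T: the maps from U to N / T are then the maps h with
    p h r = h, and all the spaces to be counted lie in Hom(M, N) and in the
    cochains on (M, N). *)

(** * Linear maps and subspaces over a finite field *)

Section FiniteVector.
Import VectorInternalTheory.
Variables (k : finFieldType) (U W : vectType k).
HB.instance Definition _ := [Finite of {vspace U} by <:].
HB.instance Definition _ := [Finite of 'Hom(U, W) by <:].
End FiniteVector.

HB.lock Definition lfun_of (k : fieldType) (U W : vectType k) (f : U -> W)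
    (f_lin : linear f) : 'Hom(U, W) :=
  linfun (HB.pack_for {linear U -> W} f (GRing.isLinear.Build k U W _ f f_lin)).

Lemma lfun_ofE (k : fieldType) (U W : vectType k) (f : U -> W)
  (f_lin : linear f) x : lfun_of f_lin x = f x.
Proof. by rewrite lfun_of.unlock lfunE. Qed.

Section Projections.
Variable k : fieldType.
Implicit Types U W : vectType k.

Lemma idem_limgP U (f : 'End(U)) x :
  (f \o f)%VF = f -> (x \in limg f) = (f x == x).
Proof.
move=> ff; apply/idP/eqP => [/memv_imgP[y _ ->]|<-]; last exact: memv_img (memvf _).
by rewrite -comp_lfunE ff.
Qed.

Lemma lfun_idemE U (f : 'End(U)) x : (f \o f)%VF = f -> f (f x) = f x.
Proof. by move=> ff; rewrite -comp_lfunE ff. Qed.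

Definition corner U W (alpha : 'End(W)) (beta : 'End(U)) :
    pred 'Hom(U, W) :=
  fun h => (alpha \o h \o beta)%VF == h.

End Projections.

Section Counting.
Variable k : finFieldType.
Implicit Types U W : vectType k.

Lemma card_lfun U W : #|{: 'Hom(U, W)}| = (#|k| ^ (\dim {: U} * \dim {: W}))%N.
Proof.
transitivity #|({: 'Hom(U, W)}%VS : {vspace 'Hom(U, W)})|.
  by apply: eq_card => h; rewrite memvf.
by rewrite card_vspace !dimvf.
Qed.

(** A map h with alpha h beta = h is determined by the map that it induces from
    the image of beta to the image of alpha, and that map is arbitrary. *)
Lemma card_corner U W (alpha : 'End(W)) (beta : 'End(U)) :
    (alpha \o alpha)%VF = alpha -> (beta \o beta)%VF = beta ->
  #|corner alpha beta| = (#|k| ^ (\dim (limg beta) * \dim (limg alpha)))%N.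
Proof.
move=> aa bb.
pose vsb := linfun (vsval : subvs_of (limg beta) -> U).
pose vpb := linfun (vsproj (limg beta)).
pose vsa := linfun (vsval : subvs_of (limg alpha) -> W).
pose vpa := linfun (vsproj (limg alpha)).
have aid w : w \in limg alpha -> alpha w = w by rewrite idem_limgP // => /eqP.
have bid w : w \in limg beta -> beta w = w by rewrite idem_limgP // => /eqP.
pose F (h : 'Hom(subvs_of (limg beta), subvs_of (limg alpha))) :=
  (vsa \o h \o vpb \o beta)%VF.
pose G (h : 'Hom(U, W)) := (vpa \o h \o vsb)%VF.
have FK : cancel F G.
  move=> h; apply/lfunP => x; rewrite /F /G !comp_lfunE !lfunE /=.
  by rewrite bid ?subvsP // !vsvalK.
have -> : #|corner alpha beta| =
    #|F @: {: 'Hom(subvs_of (limg beta), subvs_of (limg alpha))}|.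
  apply: eq_card => h; apply/eqP/imsetP => [hc|[g _ ->]].
    exists (G h) => //; apply/lfunP => x; rewrite /F /G !comp_lfunE !lfunE /=.
    have hb : beta x \in limg beta by rewrite memv_img ?memvf.
    have ha : h (beta x) \in limg alpha.
      by rewrite -hc !comp_lfunE memv_img ?memvf.
    by rewrite (vsprojK hb) (vsprojK ha) -[in LHS]hc !comp_lfunE aid.
  apply/lfunP => x; rewrite /F !comp_lfunE !lfunE /=.
  by rewrite aid ?subvsP // (lfun_idemE _ bb).
by rewrite card_imset ?card_lfun ?dim_vspace //; [rewrite !dimvf|exact: can_inj FK].
Qed.

End Counting.

(** * The two-term complex of a pair of modules *)

Section Idempotents.
Variables (k : fieldType) (V : finType) (Q : quiver V).
Implicit Types L M N : qmod k Q.

Lemma idemK M i x : idem M i (idem M i x) = idem M i x.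
Proof. by rewrite -comp_lfunE idem_orth eqxx. Qed.

Lemma idem_neq M i j x : i != j -> idem M i (idem M j x) = 0.
Proof. by move=> ij; rewrite -comp_lfunE idem_orth (negPf ij) zero_lfunE. Qed.

Lemma idem_sumE M x : \sum_i idem M i x = x.
Proof. by rewrite -sum_lfunE idem_sum id_lfunE. Qed.

Lemma idem_arr M a x : idem M (src a) (arr M a x) = arr M a x.
Proof.
by rewrite -[in LHS](arr_idem M a) -[in RHS](arr_idem M a) !comp_lfunE idemK.
Qed.

Lemma arr_idemE M a x : arr M a (idem M (tgt a) x) = arr M a x.
Proof.
by rewrite -[in LHS](arr_idem M a) -[in RHS](arr_idem M a) !comp_lfunE idemK.
Qed.

Lemma sum_idem_neq M i (F : V -> M) :
  \sum_j idem M i (idem M j (F j)) = idem M i (F i).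
Proof.
rewrite (bigD1 i) //= idemK big1 ?addr0 // => j ji.
by rewrite idem_neq // eq_sym.
Qed.

Definition graded_proj M (p : 'End(M)) : Prop :=
  (forall x, p (p x) = p x) /\ (forall i x, p (idem M i x) = idem M i (p x)).

Lemma graded_proj1 M : graded_proj (\1%VF : 'End(M)).
Proof. by split=> *; rewrite !id_lfunE. Qed.

(** Compressing any projection onto U to the vertices makes it commute with the
    idempotents; it still has image U because U is the sum of its vertex
    components. *)
Lemma graded_proj_onto M (U : {vspace M}) :
    (forall i, idem M i @: U <= U)%VS ->
  exists2 r : 'End(M), graded_proj r & limg r = U.
Proof.
move=> gU; pose r := \sum_i (idem M i \o projv U \o idem M i)%VF.
have rE x : r x = \sum_i idem M i (projv U (idem M i x)).
  by rewrite sum_lfunE; apply: eq_bigr => i _; rewrite !comp_lfunE.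
have iU i x : x \in U -> idem M i x \in U.
  by move=> xU; apply: (subvP (gU i)); rewrite memv_img.
have rU x : x \in U -> r x = x.
  move=> xU; rewrite rE -[RHS]idem_sumE; apply: eq_bigr => i _.
  by rewrite projv_id ?iU // idemK.
have Ur x : r x \in U.
  by rewrite rE; apply: memv_suml => i _; rewrite iU // memv_proj.
exists r; first split=> [x|i x].
- by rewrite [r (r x)]rU.
- rewrite !rE linear_sum sum_idem_neq (bigD1 i) //= idemK big1 ?addr0 // => j ji.
  by rewrite idem_neq // !linear0.
- apply/vspaceP => x; apply/memv_imgP/idP => [[y _ ->]|xU]; first exact: Ur.
  by exists x; rewrite ?memvf // rU.
Qed.

(** This provides an idempotent whose kernel, rather than image, is given. *)
Lemma graded_projC M (p : 'End(M)) : graded_proj p -> graded_proj (\1 - p)%VF.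
Proof.
move=> [pp pg]; split=> [x|i x]; rewrite !add_lfunE !opp_lfunE !id_lfunE.
  by rewrite linearB /= pp subrr subr0.
by rewrite linearB /= pg.
Qed.

End Idempotents.

Section Cochains.
Variables (k : fieldType) (V : finType) (Q : quiver V) (M N : qmod k Q).
Implicit Types (p : 'End(N)) (r : 'End(M)) (h : 'Hom(M, N)).

Definition cochain : Type := {ffun arrow Q -> 'Hom(M, N)}.
HB.instance Definition _ := Vector.on cochain.
Implicit Types xi zeta : cochain.

Fact sandwich_linear p r : linear (fun h : 'Hom(M, N) => (p \o h \o r)%VF).
Proof.
move=> c f g; apply/lfunP => x.
by rewrite !(comp_lfunE, add_lfunE, scale_lfunE) linearP.
Qed.

Definition vertex_map p r h : 'Hom(M, N) :=
  \sum_i ((idem N i \o p) \o h \o (idem M i \o r))%VF.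

Fact vertex_map_linear p r : linear (vertex_map p r).
Proof.
move=> c f g; rewrite scaler_sumr -big_split; apply: eq_bigr => i _.
exact: sandwich_linear.
Qed.

Definition arrow_map p r (xi : cochain) : cochain :=
  [ffun a => ((idem N (src a) \o p) \o xi a \o (idem M (tgt a) \o r))%VF].

Fact arrow_map_linear p r : linear (arrow_map p r).
Proof.
by move=> c f g; apply/ffunP => a; rewrite !ffunE /= sandwich_linear.
Qed.

Definition differential h : cochain :=
  [ffun a => commutator (arr M a) (arr N a) h].

Fact differential_linear : linear differential.
Proof. by move=> c f g; apply/ffunP => a; rewrite !ffunE linearP. Qed.

Definition vertex_proj p r := lfun_of (vertex_map_linear p r).
Definition arrow_proj p r := lfun_of (arrow_map_linear p r).
Definition delta : 'Hom('Hom(M, N), cochain) := lfun_of differential_linear.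

Lemma vertex_projE p r h x :
  vertex_proj p r h x = \sum_i idem N i (p (h (idem M i (r x)))).
Proof.
rewrite lfun_ofE sum_lfunE.
by apply: eq_bigr => i _; rewrite !comp_lfunE.
Qed.

Lemma arrow_projE p r xi a x :
  arrow_proj p r xi a x = idem N (src a) (p (xi a (idem M (tgt a) (r x)))).
Proof. by rewrite lfun_ofE ffunE !comp_lfunE. Qed.

Lemma deltaE h a x : delta h a x = h (arr M a x) - arr N a (h x).
Proof. by rewrite lfun_ofE ffunE /commutator add_lfunE opp_lfunE !comp_lfunE. Qed.

Lemma cochainP (xi zeta : cochain) : (forall a x, xi a x = zeta a x) -> xi = zeta.
Proof. by move=> e; apply/ffunP => a; apply/lfunP => x; apply: e. Qed.

Lemma cochain0 a x : (0 : cochain) a x = 0.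
Proof. by rewrite ffunE zero_lfunE. Qed.

Lemma cochainD (xi zeta : cochain) a x : (xi + zeta) a x = xi a x + zeta a x.
Proof. by rewrite ffunE add_lfunE. Qed.

Lemma cochainB (xi zeta : cochain) a x : (xi - zeta) a x = xi a x - zeta a x.
Proof. by rewrite !ffunE add_lfunE opp_lfunE. Qed.

Lemma cochainZ c (xi : cochain) a x : (c *: xi) a x = c *: xi a x.
Proof. by rewrite ffunE scale_lfunE. Qed.

(** The two terms of the complex that computes Hom and Ext^1 from the image of r
    to the image of p, realised inside the one for M and N. *)
Definition C0 p r : {vspace 'Hom(M, N)} := limg (vertex_proj p r).
Definition C1 p r : {vspace cochain} := limg (arrow_proj p r).

Section Corner.
Variables (p : 'End(N)) (r : 'End(M)).
Hypotheses (gp : graded_proj p) (gr : graded_proj r).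

Lemma C0P h : reflect
  ((forall i x, idem N i (h x) = h (idem M i x)) /\
   (forall x, p (h (r x)) = h x)) (h \in C0 p r).
Proof.
have [[pp pi] [rr ri]] := (gp, gr).
have fwd g : (forall i x, idem N i (vertex_proj p r g x) =
    vertex_proj p r g (idem M i x)) /\
   (forall x, p (vertex_proj p r g (r x)) = vertex_proj p r g x).
  split=> [i x|x]; rewrite !vertex_projE.
    rewrite linear_sum sum_idem_neq (bigD1 i) //= ri idemK big1 ?addr0 // => j ji.
    by rewrite idem_neq // !linear0.
  by rewrite linear_sum; apply: eq_bigr => i _ /=; rewrite pi pp rr.
apply: (iffP memv_imgP) => [[g _ ->]|[hi hpr]]; first exact: fwd.
exists h; rewrite ?memvf //; apply/lfunP => x; rewrite vertex_projE.
rewrite -[LHS]idem_sumE; apply: eq_bigr => i _.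
by rewrite -ri hpr -hi idemK.
Qed.

Lemma arrow_projK xi : arrow_proj p r (arrow_proj p r xi) = arrow_proj p r xi.
Proof.
have [[pp pi] [rr ri]] := (gp, gr).
by apply: cochainP => a x; rewrite !arrow_projE !pi pp idemK ri idemK rr.
Qed.

Lemma C1P xi : reflect (arrow_proj p r xi = xi) (xi \in C1 p r).
Proof.
apply: (iffP memv_imgP) => [[g _ ->]|<-]; first exact: arrow_projK.
by exists xi; rewrite ?memvf.
Qed.
End Corner.

(** Path algebras are hereditary: the complex stops in degree one, so every
    element of its last term is a cocycle. *)
Definition Z1 : {vspace cochain} := C1 \1%VF \1%VF.
Definition B1 : {vspace cochain} := (delta @: C0 \1%VF \1%VF)%VS.

Lemma Z1P xi : reflect
  (forall a x, idem N (src a) (xi a (idem M (tgt a) x)) = xi a x) (xi \in Z1).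
Proof.
apply: (iffP (C1P (graded_proj1 N) (graded_proj1 M) xi)) => e.
  by move=> a x; rewrite -[in RHS]e arrow_projE !id_lfunE.
by apply: cochainP => a x; rewrite arrow_projE !id_lfunE.
Qed.

Lemma C0_1P h : reflect (forall i x, idem N i (h x) = h (idem M i x))
  (h \in C0 \1%VF \1%VF).
Proof.
apply: (iffP (C0P (graded_proj1 N) (graded_proj1 M) h)) => [[]//|e].
by split=> // x; rewrite !id_lfunE.
Qed.

Lemma delta_Z1 h : h \in C0 \1%VF \1%VF -> delta h \in Z1.
Proof.
move/C0_1P => hi; apply/Z1P => a x.
by rewrite !deltaE linearB /= hi idem_arr arr_idemE idem_arr -hi arr_idemE.
Qed.

Lemma B1_sub_Z1 : (B1 <= Z1)%VS.
Proof. by apply/subvP => _ /memv_imgP[h hC ->]; apply: delta_Z1. Qed.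

Lemma arrow_proj_Z1 p r xi : graded_proj p -> graded_proj r ->
  arrow_proj p r xi \in Z1.
Proof.
move=> [_ pi] [_ ri]; apply/Z1P => a x.
by rewrite !arrow_projE idemK ri idemK.
Qed.
End Cochains.

Section Counting.
Variables (k : finFieldType) (V : finType) (Q : quiver V) (M N : qmod k Q).
Variables (p : 'End(N)) (r : 'End(M)).
Hypotheses (gp : graded_proj p) (gr : graded_proj r).

Let idp i : (idem N i \o p \o (idem N i \o p))%VF = (idem N i \o p)%VF.
Proof.
have [pp pi] := gp.
by apply/lfunP => x; rewrite !comp_lfunE pi pp idemK.
Qed.

Let idr i : (idem M i \o r \o (idem M i \o r))%VF = (idem M i \o r)%VF.
Proof.
have [rr ri] := gr.
by apply/lfunP => x; rewrite !comp_lfunE ri rr idemK.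
Qed.

Let sandwich_corner i j h :
  (idem N i \o p \o h \o (idem M j \o r))%VF
    \in corner (idem N i \o p)%VF (idem M j \o r)%VF.
Proof.
apply/eqP/lfunP => x; rewrite -[in RHS](idp i) -[in RHS](idr j).
by rewrite !comp_lfunE.
Qed.

Let foldr_prod (I : finType) (F : I -> nat) :
  foldr muln 1%N [seq F i | i : I] = (\prod_i F i)%N.
Proof. by rewrite foldrE big_image. Qed.

(** A cochain consists of independent choices for the arrows. *)
Lemma card_C1 : #|C1 p r| =
  (#|k| ^ (\sum_(a : arrow Q) \dim (idem M (tgt a) @: limg r) *
                             \dim (idem N (src a) @: limg p)))%N.
Proof.
transitivity #|(family (fun a : arrow Q =>
    corner (idem N (src a) \o p)%VF (idem M (tgt a) \o r)%VF))|.
  apply: eq_card => xi; apply/(C1P gp gr)/familyP => [e a|e].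
    by rewrite -e lfun_ofE ffunE sandwich_corner.
  by rewrite lfun_ofE; apply/ffunP => a; rewrite ffunE; apply/eqP/e.
rewrite card_family foldr_prod expn_sum; apply: eq_bigr => a _.
by rewrite card_corner // !limg_comp.
Qed.

(** A graded map is the sum of its vertex components, which are independent. *)
Lemma card_C0 : #|C0 p r| =
  (#|k| ^ (\sum_i \dim (idem M i @: limg r) * \dim (idem N i @: limg p)))%N.
Proof.
pose c i := corner (idem N i \o p)%VF (idem M i \o r)%VF.
transitivity #|family c|.
  have [[pp pi] [rr ri]] := (gp, gr).
  pose F (f : {ffun V -> 'Hom(M, N)}) := \sum_i f i.
  have fE f : f \in family c ->
      forall i x, f i x = idem N i (p (f i (idem M i (r x)))).
    move=> /familyP fc i x; have /eqP e := fc i.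
    by rewrite -[in LHS]e !comp_lfunE.
  have sumF f y i : f \in family c -> F f (idem M i y) = f i (idem M i y).
    move=> fc; rewrite sum_lfunE (bigD1 i) //= big1 ?addr0 // => j ji.
    by rewrite fE // ri idem_neq // !linear0.
  have Fin : {in family c &, injective F}.
    move=> f g fc gc e; apply/ffunP => i; apply/lfunP => x.
    by rewrite fE // [RHS]fE // -!sumF // e.
  rewrite -(card_in_imset Fin); apply: eq_card => h.
  apply/(C0P gp gr)/imsetP => [[hi hpr]|[f fc ->]].
    exists [ffun i => (idem N i \o p \o h \o (idem M i \o r))%VF].
      by apply/familyP => i; rewrite ffunE; apply: sandwich_corner.
    apply/lfunP => x; rewrite sum_lfunE -[LHS]idem_sumE; apply: eq_bigr => i _.
    by rewrite ffunE !comp_lfunE -ri hpr -hi idemK.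
  apply/(C0P gp gr)/memv_imgP; exists (F f); rewrite ?memvf //.
  apply/lfunP => x; rewrite vertex_projE [LHS]sum_lfunE.
  by apply: eq_bigr => i _; rewrite sumF // -fE.
rewrite card_family foldr_prod expn_sum; apply: eq_bigr => a _.
by rewrite card_corner // !limg_comp.
Qed.
End Counting.

(** * Extensions given by cochains *)

Section Twist.
Variables (k : fieldType) (V : finType) (Q : quiver V) (M N : qmod k Q).
Implicit Types xi zeta : cochain M N.

(** The idempotents around xi make this an action for an arbitrary family xi, so
    that the extension is defined without a proof that xi is a cocycle. *)
Definition twist_arr_fun xi a (x : N * M) : N * M :=
  (arr N a x.1 + idem N (src a) (xi a (idem M (tgt a) x.2)), arr M a x.2).

Fact twist_arr_linear xi a : linear (twist_arr_fun xi a).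
Proof.
move=> c x y; rewrite /twist_arr_fun /= !linearP /=; congr pair.
by rewrite addrACA -scalerDr.
Qed.

Definition twist_arr xi a : 'End((N * M)%type) := lfun_of (twist_arr_linear xi a).

Fact twist_arr_idem xi a :
  (dsum_lfun (idem N (src a)) (idem M (src a)) \o twist_arr xi a \o
     dsum_lfun (idem N (tgt a)) (idem M (tgt a)))%VF = twist_arr xi a.
Proof.
apply/lfunP => -[x y]; rewrite !comp_lfunE !dsum_lfunE !lfun_ofE /twist_arr_fun /=.
by rewrite linearD /= !idemK !arr_idemE !idem_arr.
Qed.

Definition twist xi : qmod k Q :=
  QMod (QModOn (dsum_idem_orth N M) (dsum_idem_sum N M) (twist_arr_idem xi)).

Lemma twist_idemE xi i (x : twist xi) :
  idem (twist xi) i x = (idem N i x.1, idem M i x.2).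
Proof. exact: dsum_lfunE. Qed.

Lemma twist_arrE xi a (x : twist xi) : xi \in Z1 M N ->
  arr (twist xi) a x = (arr N a x.1 + xi a x.2, arr M a x.2).
Proof. by move/Z1P => e; rewrite [LHS]lfun_ofE /twist_arr_fun e. Qed.

Lemma is_homP (A B : qmod k Q) (f : 'Hom(A, B)) :
  (forall i x, f (idem A i x) = idem B i (f x)) ->
  (forall a x, f (arr A a x) = arr B a (f x)) -> is_hom f.
Proof.
by move=> e1 e2; split=> [i|a]; apply/lfunP => x; rewrite !comp_lfunE.
Qed.

Lemma is_hom_idem (A B : qmod k Q) (f : 'Hom(A, B)) i x :
  is_hom f -> f (idem A i x) = idem B i (f x).
Proof. by case=> e _; rewrite -!comp_lfunE e. Qed.

Lemma is_hom_arr (A B : qmod k Q) (f : 'Hom(A, B)) a x :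
  is_hom f -> f (arr A a x) = arr B a (f x).
Proof. by case=> _ e; rewrite -!comp_lfunE e. Qed.

Fact inl_linear (U W : vectType k) : linear (fun x : U => (x, 0 : W)).
Proof. by move=> c x y; congr pair; rewrite /= scaler0 addr0. Qed.

Fact snd_linear (U W : vectType k) : linear (fun x : U * W => x.2).
Proof. by []. Qed.

Definition twist_in xi : 'Hom(N, twist xi) := lfun_of (@inl_linear N M).
Definition twist_out xi : 'Hom(twist xi, M) := lfun_of (@snd_linear N M).

Lemma twist_inE xi x : twist_in xi x = (x, 0).
Proof. exact: lfun_ofE. Qed.
Lemma twist_outE xi x : twist_out xi x = x.2.
Proof. exact: lfun_ofE. Qed.

Fact twist_in_hom xi : is_hom (twist_in xi).
Proof.
apply: is_homP => [i|a] x; rewrite !twist_inE.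
  by rewrite twist_idemE /= linear0.
by rewrite [RHS]lfun_ofE /twist_arr_fun /= !linear0 addr0.
Qed.

Fact twist_out_hom xi : is_hom (twist_out xi).
Proof.
apply: is_homP => [i|a] x; rewrite !twist_outE; first by rewrite twist_idemE.
by rewrite [arr _ _ _]lfun_ofE.
Qed.

Fact twist_inj xi : lker (twist_in xi) = 0%VS.
Proof. by apply/eqP/lker0P => x y; rewrite !twist_inE => -[]. Qed.

Fact twist_exact xi : limg (twist_in xi) = lker (twist_out xi).
Proof.
apply/vspaceP => -[x y]; rewrite memv_ker twist_outE /=.
apply/memv_imgP/eqP => [[z _]|->]; first by rewrite twist_inE => -[].
by exists x; rewrite ?memvf // twist_inE.
Qed.

Fact twist_surj xi : limg (twist_out xi) = fullv.
Proof.
apply/vspaceP => x; rewrite memvf; apply/memv_imgP.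
by exists (0, x); rewrite ?memvf // twist_outE.
Qed.

Definition twist_ses xi : ses M N :=
  SES (twist_in_hom xi) (twist_out_hom xi) (twist_inj xi) (twist_exact xi)
      (twist_surj xi).

End Twist.

(** * Equivalence of extensions *)

Section SesEquiv.
Variables (k : fieldType) (V : finType) (Q : quiver V) (M N : qmod k Q).
Implicit Types sigma tau rho : ses M N.

Lemma ses_in0 sigma x : ses_in sigma x = 0 -> x = 0.
Proof.
by move=> e; apply/eqP; rewrite -memv0 -(ses_inj sigma) memv_ker e.
Qed.

Lemma ses_out0P sigma x : ses_out sigma x = 0 -> exists y, x = ses_in sigma y.
Proof.
move=> e; have /memv_imgP[y _ ->] : x \in limg (ses_in sigma).
  by rewrite ses_exact memv_ker e.
by exists y.
Qed.

Lemma ses_out_in sigma x : ses_out sigma (ses_in sigma x) = 0.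
Proof.
by apply/eqP; rewrite -memv_ker -ses_exact memv_img ?memvf.
Qed.

Lemma ses_outP sigma y : exists x, y = ses_out sigma x.
Proof.
have /memv_imgP[x _ ->] : y \in limg (ses_out sigma) by rewrite ses_surj memvf.
by exists x.
Qed.

Lemma ses_equivP sigma tau : ses_equiv sigma tau <->
  exists phi : 'Hom(mid sigma, mid tau),
    [/\ is_hom phi, forall x, phi (ses_in sigma x) = ses_in tau x &
        forall x, ses_out tau (phi x) = ses_out sigma x].
Proof.
split=> -[phi [h e1 e2]]; exists phi; split=> //.
- by move=> x; rewrite -comp_lfunE e1 comp_lfun1r.
- by move=> x; rewrite -comp_lfunE e2 comp_lfun1l.
- by apply/lfunP => x; rewrite comp_lfunE e1 comp_lfun1r.
- by apply/lfunP => x; rewrite comp_lfunE e2 comp_lfun1l.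
Qed.

(** This is the short five lemma. *)
Lemma ses_equiv_bij sigma tau (phi : 'Hom(mid sigma, mid tau)) :
  (forall x, phi (ses_in sigma x) = ses_in tau x) ->
  (forall x, ses_out tau (phi x) = ses_out sigma x) ->
  (phi^-1 \o phi = \1)%VF /\ (phi \o phi^-1 = \1)%VF.
Proof.
move=> e1 e2.
have inj : lker phi == 0%VS.
  rewrite -subv0; apply/subvP => x; rewrite memv_ker memv0 => /eqP px.
  have [y xy] : exists y, x = ses_in sigma y.
    by apply: ses_out0P; rewrite -e2 px linear0.
  move: px; rewrite xy e1 => /ses_in0 ->; by rewrite linear0.
split; first exact: lker0_compVf.
apply/lfunP => y; rewrite id_lfunE comp_lfunE limg_lfunVK //.
have [x xy] := ses_outP sigma (ses_out tau y).
have [z yz] : exists z, y - phi x = ses_in tau z.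
  by apply: ses_out0P; rewrite linearB /= e2 xy subrr.
apply/memv_imgP; exists (ses_in sigma z + x); first exact: memvf.
by rewrite linearD /= e1 -yz subrK.
Qed.

Lemma is_hom_inv (A B : qmod k Q) (f : 'Hom(A, B)) (g : 'Hom(B, A)) :
  (g \o f = \1)%VF -> (f \o g = \1)%VF -> is_hom f -> is_hom g.
Proof.
move=> gf fg h.
have fgE x : f (g x) = x by rewrite -comp_lfunE fg id_lfunE.
have gfE x : g (f x) = x by rewrite -comp_lfunE gf id_lfunE.
by apply: is_homP => [i|a] x;
  rewrite -[in LHS](fgE x) -?(is_hom_idem _ _ h) -?(is_hom_arr _ _ h) gfE.
Qed.

Lemma ses_equiv_sym sigma tau : ses_equiv sigma tau -> ses_equiv tau sigma.
Proof.
move=> /ses_equivP[phi [h e1 e2]]; have [vp pv] := ses_equiv_bij e1 e2.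
apply/ses_equivP; exists (phi^-1)%VF; split.
- exact: is_hom_inv h.
- by move=> x; rewrite -e1 -comp_lfunE vp id_lfunE.
- by move=> x; rewrite -e2 -(comp_lfunE phi) pv id_lfunE.
Qed.

Lemma ses_equiv_trans sigma tau rho :
  ses_equiv sigma tau -> ses_equiv tau rho -> ses_equiv sigma rho.
Proof.
move=> /ses_equivP[phi [h e1 e2]] /ses_equivP[psi [h' e1' e2']].
apply/ses_equivP; exists (psi \o phi)%VF; split.
- apply: is_homP => [i|a] x; rewrite !comp_lfunE.
    by rewrite !is_hom_idem.
  by rewrite !is_hom_arr.
- by move=> x; rewrite comp_lfunE e1 e1'.
- by move=> x; rewrite comp_lfunE e2' e2.
Qed.

Lemma ses_equiv_iso sigma tau :
  ses_equiv sigma tau -> isomorphic (mid sigma) (mid tau).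
Proof.
move=> /ses_equivP[phi [h e1 e2]]; have [vp pv] := ses_equiv_bij e1 e2.
by exists phi, (phi^-1)%VF; split=> //; apply: is_hom_inv h.
Qed.

Lemma isomorphic_refl (A : qmod k Q) : isomorphic A A.
Proof.
by exists \1%VF, \1%VF; rewrite !comp_lfun1l; split=> //;
  apply: is_homP => *; rewrite !id_lfunE.
Qed.

Lemma isomorphic_sym (A B : qmod k Q) : isomorphic A B -> isomorphic B A.
Proof. by case=> f [g [hf hg gf fg]]; exists g, f. Qed.

Lemma isomorphic_trans (A B C : qmod k Q) :
  isomorphic A B -> isomorphic B C -> isomorphic A C.
Proof.
case=> f [g [hf hg gf fg]] [f' [g' [hf' hg' gf' fg']]].
exists (f' \o f)%VF, (g \o g')%VF; split.
- by apply: is_homP => [i|a] x; rewrite !comp_lfunE ?is_hom_idem ?is_hom_arr.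
- by apply: is_homP => [i|a] x; rewrite !comp_lfunE ?is_hom_idem ?is_hom_arr.
- by rewrite -comp_lfunA (comp_lfunA _ _ f) gf' comp_lfun1l.
- by rewrite -comp_lfunA (comp_lfunA _ _ g') fg comp_lfun1l.
Qed.
End SesEquiv.

(** * Classification of extensions by cochains *)

Section Classification.
Variables (k : fieldType) (V : finType) (Q : quiver V) (M N : qmod k Q).
Implicit Types (xi zeta : cochain M N) (sigma tau : ses M N).

Fact shear_linear (A B : vectType k) (f : 'Hom(A, B)) :
  linear (fun x : B * A => (x.1 + f x.2, x.2)).
Proof.
by move=> c x y; congr pair; rewrite /= linearP scalerDr addrACA.
Qed.

Definition shear (A B : vectType k) (f : 'Hom(A, B)) :=
  lfun_of (shear_linear f).

Lemma shearE (A B : vectType k) (f : 'Hom(A, B)) x :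
  shear f x = (x.1 + f x.2, x.2).
Proof. exact: lfun_ofE. Qed.

Fact fst_linear (U W : vectType k) : linear (fun x : U * W => x.1).
Proof. by []. Qed.

Fact inr_linear (U W : vectType k) : linear (fun x : W => (0 : U, x)).
Proof. by move=> c x y; congr pair; rewrite /= scaler0 addr0. Qed.

Lemma pair_split (A B : vectType k) (x : A * B) : x = (x.1, 0) + (0, x.2).
Proof. by case: x => a b; congr pair; rewrite ?addr0 ?add0r. Qed.

(** A map of extensions that is the identity on both ends has the form
    (x, y) |-> (x + h y, y); it commutes with the arrows exactly when h bounds
    the difference of the two cochains. *)
Lemma twist_equivP xi zeta : xi \in Z1 M N -> zeta \in Z1 M N ->
  ses_equiv (twist_ses xi) (twist_ses zeta) <-> xi - zeta \in B1 M N.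
Proof.
move=> Zxi Zze; split.
  case/ses_equivP => phi [hphi e1 e2].
  pose h : 'Hom(M, N) :=
    (lfun_of (@fst_linear N M) \o phi \o lfun_of (@inr_linear N M))%VF.
  have phiE x : phi x = (x.1 + h x.2, x.2).
    have phir y : phi (0, y) = (h y, y).
      have := e2 (0, y); rewrite /= !twist_outE !comp_lfunE !lfun_ofE /=.
      by case: (phi _) => a b /= ->.
    rewrite [x in LHS](@pair_split N M x) linearD /= phir.
    have := e1 x.1; rewrite /= !twist_inE => ->.
    by congr pair; rewrite /= add0r.
  apply/memv_imgP; exists (- h).
    rewrite memvN; apply/C0_1P => i x.
    have := @is_hom_idem _ _ _ (twist xi) (twist zeta) phi i (0, x) hphi.
    by rewrite !twist_idemE !phiE /= !linear0 !add0r => -[].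
  apply: cochainP => a x; rewrite cochainB deltaE !opp_lfunE.
  have := @is_hom_arr _ _ _ (twist xi) (twist zeta) phi a (0, x) hphi.
  rewrite !twist_arrE // !phiE /= !add0r linear0 add0r => -[E].
  by rewrite linearN opprK; apply/eqP; rewrite subr_eq -addrA -E addrC addrK.
move/memv_imgP => [h /C0_1P hi e].
apply/ses_equivP; exists (shear (- h)); split.
- apply: is_homP => [i|a] x.
    rewrite !shearE !twist_idemE /=; congr pair.
    by rewrite !opp_lfunE -hi linearD /= linearN.
  rewrite !shearE !twist_arrE //=; congr pair.
  have := cochainB xi zeta a x.2; rewrite e deltaE.
  rewrite !opp_lfunE linearB /= -addrA => E.
  rewrite -[RHS]addrA; congr (_ + _); apply/eqP.
  by rewrite subr_eq addrAC -subr_eq -E addrC.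
- by move=> x; rewrite shearE /= !twist_inE /= linear0 addr0.
- by move=> x; rewrite shearE /= !twist_outE.
Qed.

(** A graded section s of the epimorphism exists because the vertex components
    can be split separately. Its defect a s - s a lands in N and is the required
    cochain. *)
Lemma ses_twist sigma :
  exists2 xi, xi \in Z1 M N & ses_equiv (twist_ses xi) sigma.
Proof.
pose L := mid sigma; pose iota := ses_in sigma; pose pi := ses_out sigma.
have hi : is_hom iota := ses_in_hom sigma.
have hp : is_hom pi := ses_out_hom sigma.
have inj : lker iota == 0%VS by apply/eqP/ses_inj.
have piV y : pi (pi^-1%VF y) = y by rewrite limg_lfunVK // ses_surj memvf.
pose s : 'Hom(M, L) := \sum_i (idem L i \o pi^-1 \o idem M i)%VF.
have sE y : s y = \sum_i idem L i (pi^-1%VF (idem M i y)).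
  by rewrite sum_lfunE; apply: eq_bigr => i _; rewrite !comp_lfunE.
have pis y : pi (s y) = y.
  rewrite sE linear_sum -[RHS]idem_sumE; apply: eq_bigr => i _ /=.
  by rewrite is_hom_idem // piV idemK.
have si i y : s (idem M i y) = idem L i (s y).
  rewrite !sE linear_sum sum_idem_neq (bigD1 i) //= idemK big1 ?addr0 // => j ji.
  by rewrite idem_neq // !linear0.
pose xi : cochain M N :=
  [ffun a => (iota^-1 \o ((arr L a \o s) - (s \o arr M a)))%VF].
have xiE a y : iota (xi a y) = arr L a (s y) - s (arr M a y).
  rewrite ffunE comp_lfunE limg_lfunVK.
    by rewrite add_lfunE opp_lfunE !comp_lfunE.
  rewrite add_lfunE opp_lfunE !comp_lfunE ses_exact memv_ker linearB /=.
  by rewrite (is_hom_arr _ _ hp) !pis subrr.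
have Zxi : xi \in Z1 M N.
  apply/Z1P => a y; have iinj : injective iota by apply/lker0P.
  apply: iinj; rewrite (is_hom_idem _ _ hi) !xiE.
  by rewrite linearB /= -si !si arr_idemE idem_arr -si arr_idemE idem_arr.
exists xi => //; apply/ses_equivP.
have f_lin : linear (fun x : N * M => iota x.1 + s x.2).
  by move=> c x y; rewrite /= !linearP /= scalerDr addrACA.
exists (lfun_of f_lin : 'Hom(twist xi, L)); split.
- apply: is_homP => [i|a] x; rewrite [LHS]lfun_ofE [X in _ = _ X]lfun_ofE.
    by rewrite twist_idemE /= linearD /= is_hom_idem // si.
  by rewrite twist_arrE //= linearD /= linearD /= is_hom_arr // xiE -addrA subrK.
- by move=> x; rewrite [LHS]lfun_ofE /= twist_inE linear0 addr0.
- by move=> x; rewrite [RHS]twist_outE lfun_ofE linearD /= pis ses_out_in add0r.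
Qed.
End Classification.

Section Representatives.
Variables (k : fieldType) (V : finType) (Q : quiver V) (M N : qmod k Q).
Implicit Types (sigma tau : ses M N) (P : ses M N -> Prop).

(** The property P selects the extensions to be classified: all of them for the
    dimension of Ext^1, those with a prescribed middle term for [eps]. Any two
    such systems have the same size, which pins down the values chosen in the
    definitions of [ext1_dim] and [eps]. *)
Definition ses_reps P (I : finType) (phi : I -> ses M N) : Prop :=
  [/\ forall i, P (phi i), forall i j, ses_equiv (phi i) (phi j) -> i = j &
      forall sigma, P sigma -> exists i, ses_equiv (phi i) sigma].

Lemma ses_reps_leq P (I J : finType) (phi : I -> ses M N) (psi : J -> ses M N) :
  ses_reps P phi -> ses_reps P psi -> (#|I| <= #|J|)%N.
Proof.
case=> [Pphi iphi _] [_ _ spsi].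
have [f fE] : exists f : I -> J, forall i, ses_equiv (psi (f i)) (phi i).
  by have [f fP] := choice (fun i => spsi _ (Pphi i)); exists f.
apply: (leq_card f) => i j e; apply: iphi.
by apply: ses_equiv_trans (fE j); rewrite -e; apply: ses_equiv_sym.
Qed.

Lemma ses_reps_card P (I J : finType) (phi : I -> ses M N) (psi : J -> ses M N) :
  ses_reps P phi -> ses_reps P psi -> #|I| = #|J|.
Proof.
by move=> h h'; apply/eqP; rewrite eqn_leq !(ses_reps_leq h h', ses_reps_leq h' h).
Qed.
End Representatives.

(** * The dimension of Ext and the number of extensions *)

Section ExtLinear.
Variables (k : fieldType) (V : finType) (Q : quiver V) (M N : qmod k Q).
Implicit Types (xi zeta : cochain M N).

Lemma is_scaling_twist c xi : xi \in Z1 M N ->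
  is_scaling c (twist_ses xi) (twist_ses (c *: xi)).
Proof.
move=> Zxi; have Zc : c *: xi \in Z1 M N by apply: memvZ.
have f_lin : linear (fun x : N * M => (c *: x.1, x.2)).
  by move=> d x y; congr pair; rewrite /= scalerDr !scalerA mulrC.
pose f : 'Hom(twist xi, twist (c *: xi)) := lfun_of f_lin.
have fE x : f x = (c *: x.1, x.2) by apply: lfun_ofE.
exists f; split.
- apply: is_homP => [i|a] x; rewrite !fE.
    by rewrite !twist_idemE /= linearZ.
  by rewrite !twist_arrE //= cochainZ scalerDr linearZ.
- apply/lfunP => x; rewrite !comp_lfunE /= fE !twist_inE /=.
  by rewrite scale_lfunE id_lfunE.
- by apply/lfunP => x; rewrite !comp_lfunE /= fE !twist_outE id_lfunE.
Qed.

Lemma dsum_idemE (A B : qmod k Q) i (x : dsum A B) :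
  idem (dsum A B) i x = (idem A i x.1, idem B i x.2).
Proof. exact: dsum_lfunE. Qed.

Lemma dsum_arrE (A B : qmod k Q) a (x : dsum A B) :
  arr (dsum A B) a x = (arr A a x.1, arr B a x.2).
Proof. exact: dsum_lfunE. Qed.

Lemma ses_in_twist (A B : qmod k Q) (w : cochain A B) x :
  ses_in (twist_ses w) x = (x, 0).
Proof. exact: twist_inE. Qed.

Lemma ses_out_twist (A B : qmod k Q) (w : cochain A B) x :
  ses_out (twist_ses w) x = x.2.
Proof. exact: twist_outE. Qed.

Lemma ses_in_dsum (A B A' B' : qmod k Q) (s : ses A B) (t : ses A' B') x :
  ses_in (ses_dsum s t) x = (ses_in s x.1, ses_in t x.2).
Proof. exact: dsum_lfunE. Qed.

Lemma ses_out_dsum (A B A' B' : qmod k Q) (s : ses A B) (t : ses A' B') x :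
  ses_out (ses_dsum s t) x = (ses_out s x.1, ses_out t x.2).
Proof. exact: dsum_lfunE. Qed.

(** The extension of M by N + N given by the pair (xi, zeta) is the pullback of
    the direct sum of the two extensions along the diagonal of M, and its pushout
    along the addition of N is given by xi + zeta. *)
Lemma is_baer_sum_twist xi zeta : xi \in Z1 M N -> zeta \in Z1 M N ->
  is_baer_sum (twist_ses xi) (twist_ses zeta) (twist_ses (xi + zeta)).
Proof.
move=> Zxi Zze; have Zs : xi + zeta \in Z1 M N by apply: memvD.
have w_lin a : linear (fun y : M => (xi a y, zeta a y)).
  by move=> c x y; rewrite !linearP.
pose w : cochain M (dsum N N) := [ffun a => lfun_of (w_lin a)].
have wE a y : w a y = (xi a y, zeta a y) by rewrite ffunE lfun_ofE.
have Zw : w \in Z1 M (dsum N N).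
  apply/Z1P => a y; rewrite dsum_idemE !wE /=.
  by move: Zxi Zze => /Z1P -> /Z1P ->.
exists (twist_ses w); split.
  have f_lin : linear (fun x : (N * N) * M => ((x.1.1, x.2), (x.1.2, x.2))) by [].
  pose f : 'Hom(twist w, dsum (twist xi) (twist zeta)) := lfun_of f_lin.
  have fE x : f x = ((x.1.1, x.2), (x.1.2, x.2)) by apply: lfun_ofE.
  have f_hom : is_hom f.
    apply: is_homP => [i|a] x; rewrite !fE.
      rewrite (@dsum_idemE (twist xi) (twist zeta)) (@twist_idemE _ _ _ _ _ w).
      by rewrite (@twist_idemE _ _ _ _ _ xi) (@twist_idemE _ _ _ _ _ zeta) dsum_idemE.
    rewrite (@dsum_arrE (twist xi) (twist zeta)) (twist_arrE _ _ Zw).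
    by rewrite (twist_arrE _ _ Zxi) (twist_arrE _ _ Zze) dsum_arrE wE.
  exists f; split=> //.
  - apply/lfunP => x; rewrite [LHS]comp_lfunE [RHS]comp_lfunE id_lfunE.
    by rewrite !ses_in_twist fE ses_in_dsum !ses_in_twist.
  - apply/lfunP => x; rewrite [LHS]comp_lfunE [RHS]comp_lfunE fE.
    by rewrite diag_lfunE ses_out_dsum !ses_out_twist.
have f_lin : linear (fun x : (N * N) * M => (x.1.1 + x.1.2, x.2)).
  by move=> c x y; congr pair; rewrite /= scalerDr addrACA.
pose f : 'Hom(twist w, twist (xi + zeta)) := lfun_of f_lin.
have fE x : f x = (x.1.1 + x.1.2, x.2) by apply: lfun_ofE.
exists f; split.
- apply: is_homP => [i|a] x; rewrite !fE.
    rewrite (@twist_idemE _ _ _ _ _ w) (@twist_idemE _ _ _ _ _ (xi + zeta)).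
    by rewrite dsum_idemE linearD.
  rewrite (twist_arrE _ _ Zw) (twist_arrE _ _ Zs) dsum_arrE wE /=.
  by rewrite cochainD linearD /= addrACA.
- apply/lfunP => x; rewrite [LHS]comp_lfunE [RHS]comp_lfunE.
  by rewrite !ses_in_twist fE codiag_lfunE.
- apply/lfunP => x; rewrite [LHS]comp_lfunE [RHS]comp_lfunE id_lfunE.
  by rewrite !ses_out_twist fE.
Qed.

(** A complement of the coboundaries contains exactly one cochain from each
    class, which avoids quotients. *)
Definition ext_cochains : {vspace cochain M N} := (Z1 M N :\: B1 M N)%VS.

Lemma ext_cochains_Z1 xi : xi \in ext_cochains -> xi \in Z1 M N.
Proof. exact: (subvP (diffvSl _ _)). Qed.

Lemma ext_cochains_uniq xi zeta : xi \in ext_cochains -> zeta \in ext_cochains ->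
  ses_equiv (twist_ses xi) (twist_ses zeta) -> xi = zeta.
Proof.
move=> cx cz; rewrite twist_equivP ?ext_cochains_Z1 // => b.
apply/eqP; rewrite -subr_eq0 -memv0 -(capv_diff (Z1 M N) (B1 M N)) memv_cap b.
by rewrite memvB.
Qed.

Lemma Z1_decomp xi : xi \in Z1 M N ->
  exists2 c, c \in ext_cochains & exists2 b, b \in B1 M N & xi = c + b.
Proof.
rewrite -{1}(addv_diff_cap (Z1 M N) (B1 M N)) => /memv_addP[c cC [b bB e]].
by exists c => //; exists b => //; move: bB; rewrite memv_cap => /andP[].
Qed.

Lemma dim_Z1 : \dim (Z1 M N) = (\dim ext_cochains + \dim (B1 M N))%N.
Proof.
by rewrite -(dimv_cap_compl (Z1 M N) (B1 M N)) addnC (capv_idPr (B1_sub_Z1 _ _)).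
Qed.

Lemma ext_cochains_surj (sigma : ses M N) :
  exists2 c, c \in ext_cochains & ses_equiv (twist_ses c) sigma.
Proof.
have [xi Zxi e] := ses_twist sigma.
have [c cC [b bB xiE]] := Z1_decomp Zxi; exists c => //.
apply: ses_equiv_trans e; apply/(twist_equivP (ext_cochains_Z1 cC) Zxi).
by rewrite xiE opprD addNKr memvN.
Qed.

Lemma is_ext1_dim_cochains : is_ext1_dim M N (\dim ext_cochains).
Proof.
pose d := \dim ext_cochains; pose e := vbasis ext_cochains.
pose psi (u : 'rV[k]_d) := \sum_i u 0 i *: e`_i.
have psiC u : psi u \in ext_cochains.
  by apply: memv_suml => i _; rewrite memvZ // vbasis_mem // mem_nth // size_tuple.
have psiZ u := ext_cochains_Z1 (psiC u).
have psiD u w : psi (u + w) = psi u + psi w.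
  by rewrite -big_split; apply: eq_bigr => i _; rewrite mxE scalerDl.
have psiS c u : psi (c *: u) = c *: psi u.
  by rewrite scaler_sumr; apply: eq_bigr => i _; rewrite mxE scalerA.
exists (fun u => twist_ses (psi u)); split.
- move=> u w /ext_cochains_uniq -/(_ (psiC _) (psiC _)) E.
  apply/rowP => i.
  rewrite -[LHS](coord_sum_free (u 0) _ (basis_free (vbasisP ext_cochains))).
  by rewrite -/(psi u) E coord_sum_free ?(basis_free (vbasisP _)).
- move=> sigma; have [c cC ce] := ext_cochains_surj sigma.
  exists (\row_i coord e i c); suff -> : psi (\row_i coord e i c) = c by [].
  rewrite [RHS](coord_vbasis cC); apply: eq_bigr => i _.
  by rewrite mxE.
- by move=> u w; rewrite psiD; apply: is_baer_sum_twist.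
- by move=> c u; rewrite psiS; apply: is_scaling_twist.
Qed.
End ExtLinear.

Section ExtCount.
Variables (k : finFieldType) (V : finType) (Q : quiver V) (M N : qmod k Q).

(** Over a finite field, two linear parametrisations of the classes have the same
    number of elements, hence the same dimension. *)
Lemma ext1_dimE : ext1_dim M N = \dim (ext_cochains M N).
Proof.
have red d (phi : 'rV[k]_d -> ses M N) :
    (forall u w, ses_equiv (phi u) (phi w) -> u = w) ->
    (forall xi, exists u, ses_equiv (phi u) xi) ->
  ses_reps (fun=> True) phi by move=> h1 h2; split.
apply: xget_unique => [|d]; first exact: is_ext1_dim_cochains.
case=> phi [i1 s1 _ _]; have [psi [i2 s2 _ _]] := is_ext1_dim_cochains M N.
have := ses_reps_card (red _ _ i1 s1) (red _ _ i2 s2).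
by rewrite !card_mx !mul1n => /eqP; rewrite eqn_exp2l ?finNzRing_gt1 // => /eqP.
Qed.

Definition ext_iso (E : qmod k Q) : pred (cochain M N) :=
  fun c => (c \in ext_cochains M N) && `[< isomorphic (twist c) E >].

Lemma epsE (E : qmod k Q) : eps M N E = #|ext_iso E|.
Proof.
have H : is_eps M N E #|ext_iso E|.
  exists (fun i => twist_ses (enum_val i)); split=> [i|i j e|sigma iso].
  - by have /andP[_ /asboolP] := enum_valP i.
  - apply: enum_val_inj; apply: ext_cochains_uniq e.
      by have /andP[] := enum_valP i.
    by have /andP[] := enum_valP j.
  - have [c cC ce] := ext_cochains_surj sigma.
    have cE : c \in ext_iso E.
      rewrite unfold_in cC; apply/asboolP.
      exact: isomorphic_trans (ses_equiv_iso ce) iso.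
    by exists (enum_rank_in cE c); rewrite enum_rankK_in.
apply: xget_unique => // d [phi h].
have [psi h'] := H.
by have := ses_reps_card h h'; rewrite !card_ord.
Qed.
End ExtCount.

(** * The Euler form *)

Section Euler.
Variables (k : finFieldType) (V : finType) (Q : quiver V) (M N : qmod k Q).

Let vdim (L : qmod k Q) i := \dim (idem L i @: {:L}).

Lemma limg1 (L : vectType k) : limg (\1%VF : 'End(L)) = fullv.
Proof. exact: lim1g. Qed.

Lemma dim_C1 p r : graded_proj p -> graded_proj r ->
  \dim (@C1 _ _ _ M N p r) =
  (\sum_(a : arrow Q) \dim (idem M (tgt a) @: limg r) *
                      \dim (idem N (src a) @: limg p))%N.
Proof.
move=> gp gr; apply/eqP; rewrite -(eqn_exp2l _ _ (finNzRing_gt1 k)).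
by rewrite -card_vspace card_C1.
Qed.

Lemma dim_C0 p r : graded_proj p -> graded_proj r ->
  \dim (@C0 _ _ _ M N p r) =
  (\sum_i \dim (idem M i @: limg r) * \dim (idem N i @: limg p))%N.
Proof.
move=> gp gr; apply/eqP; rewrite -(eqn_exp2l _ _ (finNzRing_gt1 k)).
by rewrite -card_vspace card_C0.
Qed.

Lemma hom_spaceE : hom_space M N = (C0 \1%VF \1%VF :&: lker (delta M N))%VS.
Proof.
apply/vspaceP => f; rewrite [RHS]memv_cap.
apply/idP/andP => [/hom_spaceP h|[/C0_1P h1 h2]].
  split; first by apply/C0_1P => i x; rewrite is_hom_idem.
  rewrite memv_ker; apply/eqP/cochainP => a x.
  by rewrite deltaE is_hom_arr // subrr cochain0.
apply/hom_spaceP/is_homP => [i|a] x; first by rewrite h1.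
move: h2; rewrite memv_ker => /eqP h2; apply/eqP.
by rewrite -subr_eq0 -deltaE h2 cochain0.
Qed.

(** Hom and Ext^1 are the kernel and the cokernel of [delta], so the difference of
    their dimensions is that of its source and target. *)
Lemma eulerE : euler M N =
  (\sum_i vdim M i * vdim N i)%N%:Z -
  (\sum_(a : arrow Q) vdim M (tgt a) * vdim N (src a))%N%:Z.
Proof.
have h := dim_C0 (graded_proj1 N) (graded_proj1 M).
have e := dim_C1 (graded_proj1 N) (graded_proj1 M).
rewrite !limg1 in h e; rewrite -h -e.
rewrite -(limg_ker_dim (delta M N)) -hom_spaceE -/(B1 M N) -/(Z1 M N) dim_Z1.
by rewrite /euler ext1_dimE !PoszD opprD addrACA subrr addr0.
Qed.
End Euler.

Section EulerSimple.
Variables (k : finFieldType) (V : finType) (Q : quiver V).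

Lemma dim_simple (i0 i : V) : \dim (idem (simple k Q i0) i @: fullv)%VS = (i == i0).
Proof.
rewrite /idem /=; case: eqP => _; first by rewrite lim1g dimvf.
by rewrite lim0g dimv0.
Qed.

(** All arrows act by zero on simple modules, so there are no coboundaries. *)
Lemma ext1_dim_simple (i j : V) :
  ext1_dim (simple k Q i) (simple k Q j) = #|arrows_between Q j i|.
Proof.
have B0 : B1 (simple k Q i) (simple k Q j) = 0%VS.
  apply/eqP; rewrite -lkerE; apply/subvP => h _; rewrite memv_ker.
  apply/eqP/cochainP => a x.
  by rewrite deltaE cochain0 /arr /= !zero_lfunE linear0 subrr.
have := dim_Z1 (simple k Q i) (simple k Q j).
rewrite B0 dimv0 addn0 ext1_dimE => <-.
rewrite (dim_C1 (graded_proj1 _) (graded_proj1 _)) !limg1.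
rewrite -sum1_card [RHS]big_mkcond /=; apply: eq_bigr => a _.
by rewrite !dim_simple inE mulnb andbC; case: (_ && _).
Qed.

Lemma euler_simple (i j : V) : euler (simple k Q i) (simple k Q j) =
  (i == j)%:Z - #|arrows_between Q j i|%:Z.
Proof.
rewrite eulerE; congr (_%:Z - _%:Z).
  rewrite (bigD1 i) //= !dim_simple eqxx mul1n big1 ?addn0 // => l /negPf li.
  by rewrite !dim_simple li.
rewrite -sum1_card [RHS]big_mkcond /=; apply: eq_bigr => a _.
by rewrite !dim_simple inE mulnb andbC; case: (_ && _).
Qed.
End EulerSimple.

(** * Submodules of an extension *)

Section Submodules.
Variables (k : fieldType) (V : finType) (Q : quiver V).

Lemma is_submodP (M : qmod k Q) (U : {vspace M}) : is_submod U <->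
  (forall i x, x \in U -> idem M i x \in U) /\
  (forall a x, x \in U -> arr M a x \in U).
Proof.
split=> -[h1 h2]; split.
- by move=> i x xU; apply: (subvP (h1 i)) (memv_img _ xU).
- by move=> a x xU; apply: (subvP (h2 a)) (memv_img _ xU).
- by move=> i; apply/subvP => _ /memv_imgP[x xU ->]; apply: h1.
- by move=> a; apply/subvP => _ /memv_imgP[x xU ->]; apply: h2.
Qed.

Lemma idem_imgP (M : qmod k Q) (U : {vspace M}) i x :
  (forall y, y \in U -> idem M i y \in U) ->
  (x \in (idem M i @: U)%VS) = (x \in U) && (idem M i x == x).
Proof.
move=> hU; apply/memv_imgP/andP => [[y yU ->]|[xU /eqP e]].
  by rewrite hU // idemK.
by exists x.
Qed.

(** This is rank and nullity for p on the component at i, which p preserves. *)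
Lemma dim_idem_proj (M : qmod k Q) (p : 'End(M)) i : graded_proj p ->
  \dim (idem M i @: fullv) =
  (\dim (idem M i @: lker p) + \dim (idem M i @: limg p))%N.
Proof.
move=> [pp pi]; rewrite -(limg_ker_dim p).
have kp y : y \in lker p -> idem M i y \in lker p.
  by rewrite !memv_ker pi => /eqP ->; rewrite linear0.
congr (_ + _)%N.
  congr (\dim _); apply/vspaceP => x; rewrite memv_cap [in RHS]idem_imgP //.
  by rewrite idem_imgP => [|y _]; rewrite memvf // andbC.
rewrite -!limg_comp; suff -> : (p \o idem M i = idem M i \o p)%VF by [].
by apply/lfunP => y; rewrite !comp_lfunE pi.
Qed.

Variables (M N : qmod k Q).
Implicit Types (xi : cochain M N) (W : {vspace (N * M)%type}).

Definition sub_part W : {vspace N} := (lfun_of (@inl_linear _ N M) @^-1: W)%VS.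
Definition quo_part W : {vspace M} := (lfun_of (@snd_linear _ N M) @: W)%VS.

Lemma sub_partP W n : (n \in sub_part W) = ((n, 0) \in W).
Proof. by rewrite -memv_preim lfun_ofE. Qed.

Lemma quo_partP W m : reflect (exists n, (n, m) \in W) (m \in quo_part W).
Proof.
apply: (iffP memv_imgP) => [[[n m'] xW ->]|[n xW]].
  by exists n; rewrite lfun_ofE.
by exists (n, m); rewrite // lfun_ofE.
Qed.

Lemma quo_part_mem W (x : N * M) : x \in W -> x.2 \in quo_part W.
Proof. by case: x => n m xW; apply/quo_partP; exists n. Qed.

Section Part.
Variables (xi : cochain M N) (W : {vspace twist xi}).
Hypotheses (Zxi : xi \in Z1 M N) (sW : is_submod W).

Let iW i (x : twist xi) : x \in W -> (idem N i x.1, idem M i x.2) \in W.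
Proof. by case/is_submodP: sW => h _ /(h i); rewrite twist_idemE. Qed.

Let aW a (x : twist xi) : x \in W -> (arr N a x.1 + xi a x.2, arr M a x.2) \in W.
Proof. by case/is_submodP: sW => _ h /(h a); rewrite twist_arrE. Qed.

Lemma quo_part_submod : is_submod (quo_part W).
Proof.
apply/is_submodP; split=> [i|a] m /quo_partP[n /[dup] xW]; [move/(iW i)|move/(aW a)].
  by move=> xiW; apply/quo_partP; eexists; apply: xiW.
by move=> xiW; apply/quo_partP; eexists; apply: xiW.
Qed.

Lemma sub_part_submod : is_submod (sub_part W).
Proof.
apply/is_submodP; split=> [i|a] n; rewrite !sub_partP; [move/(iW i)|move/(aW a)].
  by rewrite /= linear0.
by rewrite /= !linear0 addr0.
Qed.

(** W is an extension of its image in M by its trace on N, and taking components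
    at a vertex is exact. *)
Lemma dim_idem_parts i : \dim (idem (twist xi) i @: W) =
  (\dim (idem N i @: sub_part W) + \dim (idem M i @: quo_part W))%N.
Proof.
have [h1 _] := is_submodP W; have {h1}[h1 _] := h1 sW.
have [hs _] := is_submodP (sub_part W); have {hs}[hs _] := hs sub_part_submod.
pose sn : 'Hom(twist xi, M) := lfun_of (@snd_linear _ N M).
have snE x : sn x = x.2 by apply: lfun_ofE.
pose il : 'Hom(N, twist xi) := lfun_of (@inl_linear _ N M).
have ilE x : il x = (x, 0) by apply: lfun_ofE.
have il0 : lker il == 0%VS by apply/lker0P => x y; rewrite !ilE => -[].
rewrite -(limg_ker_dim sn); congr (_ + _)%N.
  rewrite -[RHS](@limg_dim_eq _ _ _ il); last first.
    by rewrite (eqP il0) capv0.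
  congr (\dim _); apply/vspaceP => x; rewrite memv_cap memv_ker snE.
  rewrite (@idem_imgP (twist xi)) //; last by move=> y; apply: h1.
  apply/andP/memv_imgP => [[/andP[xW /eqP e] /eqP x2]|[n]].
    exists x.1; last by rewrite ilE [LHS]surjective_pairing x2.
    rewrite idem_imgP => [|y]; last exact: hs.
    rewrite sub_partP -x2 -surjective_pairing xW.
    by have := congr1 fst e; rewrite twist_idemE /= => ->.
  rewrite idem_imgP => [/andP[nW /eqP e] ->|y]; last exact: hs.
  rewrite sub_partP in nW.
  by rewrite ilE nW twist_idemE /= e linear0 eqxx.
rewrite -[quo_part W]/(sn @: W)%VS -!limg_comp.
congr (\dim (_ @: _)); apply/lfunP => x; rewrite !comp_lfunE.
by rewrite snE twist_idemE lfun_ofE.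
Qed.
End Part.

Section Fiber.
Variables (U : {vspace M}) (T : {vspace N}) (p : 'End(N)) (r : 'End(M)).
Hypotheses (sU : is_submod U) (sT : is_submod T).
Hypotheses (gp : graded_proj p) (gr : graded_proj r).
Hypotheses (kp : lker p = T) (lr : limg r = U).

Let pT n : (n \in T) = (p n == 0).
Proof. by rewrite -kp memv_ker. Qed.

Let rU m : m \in U -> r m = m.
Proof.
have [rr _] := gr.
by rewrite -lr => /memv_imgP[y _ ->].
Qed.

Let Ur m : r m \in U.
Proof. by rewrite -lr memv_img ?memvf. Qed.

(** The kernel of this map consists of the pairs (n, m) with m in U and n equal to
    h m modulo T. *)
Fact graph_fun_linear (h : 'Hom(M, N)) :
  linear (fun x : N * M => (p (x.1 - h x.2), x.2 - r x.2)).
Proof.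
move=> c x y; congr pair; rewrite /=.
  by rewrite [h _]linearP opprD addrACA -scalerBr linearP.
by rewrite linearP opprD addrACA -scalerBr.
Qed.

Definition graph_sub h : {vspace (N * M)%type} := lker (lfun_of (graph_fun_linear h)).

Lemma mem_graph_sub h x : (x \in graph_sub h) = (x.1 - h x.2 \in T) && (x.2 \in U).
Proof.
rewrite memv_ker lfun_ofE pT -[0]/(0, 0) xpair_eqE; congr (_ && _).
by apply/eqP/idP => [/eqP|/rU ->]; rewrite ?subrr // subr_eq0 => /eqP ->.
Qed.

Lemma quo_part_graph h : quo_part (graph_sub h) = U.
Proof.
apply/vspaceP => m; apply/quo_partP/idP => [[n]|mU].
  by rewrite mem_graph_sub => /andP[].
by exists (h m); rewrite mem_graph_sub /= subrr mem0v.
Qed.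

Lemma sub_part_graph h : sub_part (graph_sub h) = T.
Proof.
by apply/vspaceP => n; rewrite sub_partP mem_graph_sub /= linear0 subr0 mem0v andbT.
Qed.

Lemma graph_sub_inj : {in C0 p r &, injective graph_sub}.
Proof.
have [rr _] := gr.
move=> h h' /(C0P gp gr)[_ e] /(C0P gp gr)[_ e'] E; apply/lfunP => m.
have : (h (r m), r m) \in graph_sub h by rewrite mem_graph_sub /= subrr mem0v Ur.
rewrite E mem_graph_sub /= pT linearB /= subr_eq0 => /andP[/eqP E' _].
by rewrite -e -e' E'.
Qed.

(** The map h sends m to the class modulo T, represented through p, of any n with
    (n, r m) in W. *)
Lemma graph_sub_surj W :
  (forall i x, x \in W -> (idem N i x.1, idem M i x.2) \in W) ->
  quo_part W = U -> sub_part W = T -> exists2 h, h \in C0 p r & W = graph_sub h.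
Proof.
have [pp pi] := gp; have [rr ri] := gr.
move=> iW quoW subW.
pose sn : 'Hom((N * M)%type, M) := lfun_of (@snd_linear _ N M).
pose fs : 'Hom((N * M)%type, N) := lfun_of (@fst_linear _ N M).
have snE x : sn x = x.2 by apply: lfun_ofE.
have fsE x : fs x = x.1 by apply: lfun_ofE.
pose g := (sn \o projv W)%VF.
pose s := (projv W \o g^-1 \o r)%VF.
have sW m : s m \in W by rewrite /s !comp_lfunE memv_proj.
have s2 m : (s m).2 = r m.
  rewrite -snE -[LHS]/(sn (s m)) /s !comp_lfunE.
  have -> : sn (projv W ((g^-1)%VF (r m))) = g ((g^-1)%VF (r m)) by rewrite comp_lfunE.
  by rewrite limg_lfunVK // limg_comp limg_proj -/(quo_part W) quoW.
pose h := (p \o fs \o s)%VF.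
have hE m : h m = p (s m).1 by rewrite !comp_lfunE fsE.
have hr m : h (r m) = h m by rewrite !hE /s !comp_lfunE rr.
have key x : x \in W -> p x.1 = h x.2.
  move=> xW; have x2U : x.2 \in U by rewrite -quoW quo_part_mem.
  apply/eqP; rewrite hE -subr_eq0 -linearB /= -pT -subW sub_partP.
  have -> : (x.1 - (s x.2).1, 0) = x - s x.2.
    by rewrite [RHS]surjective_pairing /= s2 rU // subrr.
  by rewrite memvB.
exists h.
  apply/(C0P gp gr); split=> [i m|m]; last by rewrite hr hE pp.
  rewrite [in LHS]hE -pi -[RHS]hr ri -s2.
  exact: (key (_, _) (iW i _ (sW m))).
apply/vspaceP => x; rewrite mem_graph_sub; apply/idP/andP => [xW|[x1 x2]].
  rewrite -quoW quo_part_mem // pT linearB /= key // hE pp subrr.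
  by split.
have e : (x.1 - (s x.2).1, 0) = x - s x.2.
  by rewrite [RHS]surjective_pairing /= s2 rU // subrr.
have : x - s x.2 \in W.
  rewrite -e -sub_partP subW pT linearB /= -hE subr_eq0.
  by move: x1; rewrite pT linearB /= [in p (h _)]hE pp -hE subr_eq0.
by move/(fun y => memvD y (sW x.2)); rewrite subrK.
Qed.

(** The graph is stable under an arrow a when a h u + xi_a u and h (a u) agree
    modulo T for all u in U, that is, when p (xi - delta h) r vanishes. *)
Lemma graph_sub_submod xi h : xi \in Z1 M N -> h \in C0 p r ->
  @is_submod _ _ _ (twist xi) (graph_sub h) <->
  xi - delta M N h \in lker (arrow_proj p r).
Proof.
have [pp pi] := gp; have [rr ri] := gr.
move=> Zxi /(C0P gp gr)[hi hpr].
have hC : h \in C0 \1%VF \1%VF by apply/C0_1P.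
have Zw : xi - delta M N h \in Z1 M N by rewrite memvB // delta_Z1.
have [[iU aU] [iT aT]] := (iffLR (is_submodP U) sU, iffLR (is_submodP T) sT).
have stepE a (x : N * M) : arr N a x.1 + xi a x.2 - h (arr M a x.2) =
    arr N a (x.1 - h x.2) + (xi - delta M N h) a x.2.
  rewrite cochainB deltaE linearB /= opprB.
  by rewrite -[LHS]addrA -[RHS]addrA; congr (_ + _); rewrite [RHS]addrCA addKr.
split=> [/is_submodP[_ ha]|].
  rewrite memv_ker; apply/eqP/cochainP => a x; rewrite arrow_projE -ri.
  suff -> u : u \in U -> p ((xi - delta M N h) a u) = 0.
  - by rewrite linear0 cochain0.
  - exact: Ur.
  move=> uU; have : (h u, u) \in graph_sub h.
    by rewrite mem_graph_sub /= subrr mem0v uU.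
  move/(ha a); rewrite twist_arrE // mem_graph_sub /= => /andP[+ _].
  by rewrite (stepE a (_, _)) /= subrr linear0 add0r pT => /eqP.
rewrite memv_ker => /eqP Pw.
have wT a m : m \in U -> (xi - delta M N h) a m \in T.
  move=> mU; rewrite pT; have := congr1 (fun w : cochain M N => w a m) Pw => /=.
  rewrite arrow_projE rU // -pi.
  by move/Z1P: Zw => ->; rewrite cochain0 => ->.
apply/is_submodP; split=> [i|a] x.
  rewrite !mem_graph_sub twist_idemE /= => /andP[x1 x2].
  by rewrite -hi -linearB /= iT // iU.
rewrite !mem_graph_sub twist_arrE //= => /andP[x1 x2].
by rewrite (stepE a x) memvD ?aT ?wT // aU.
Qed.

End Fiber.
End Submodules.

(** * Counting submodules over all cochains *)

Section FiberSums.

Lemma card_fset_set_fin (T : finType) (A : set T) :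
  #|` fset_set A| = #|[pred x | x \in A]|.
Proof.
have fA : finite_set A by apply: finite_finset.
rewrite -(card_uniqP (fset_uniq _)); apply: eq_card => x.
by rewrite inE -in_fset_set.
Qed.

(** This converts the sums over an infinite index set, which weight each index by
    the size of a fibre, into sums over the finite set that is fibred: dimension
    vectors into submodules, and isomorphism classes into cochains. *)
Lemma fsbig_fibers (T : finType) (I : choiceType) (L : nmodType) (P : pred T)
    (D : set I) (f : T -> I) (F : I -> L) : (forall t, P t -> D (f t)) ->
  \sum_(i \in D) (F i *+ #|[pred t | P t & f t == i]|) = \sum_(t | P t) F (f t).
Proof.
move=> fD; pose r := undup [seq f t | t in P].
have rP i : (i \in r) = [exists t, P t && (f t == i)].
  rewrite mem_undup; apply/mapP/existsP => [[t]|[t /andP[Pt /eqP <-]]].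
    by rewrite mem_enum => Pt ->; exists t; rewrite [P t]Pt eqxx.
  by exists t; rewrite // mem_enum.
rewrite (fsbigE r) ?undup_uniq //; first last.
- move=> i _; rewrite rP => /existsPn h.
  by rewrite eq_card0 ?mulr0n // => t; apply/negP; apply/negP/h.
- by move=> i /=; rewrite rP => /existsP[t /andP[Pt /eqP <-]]; apply: fD.
under eq_bigr => i _ do rewrite -sumr_const /=.
rewrite (exchange_big_dep P) /=; last by move=> i t _ /andP[].
apply: eq_bigr => t Pt.
have tr : f t \in r by rewrite rP; apply/existsP; exists t; rewrite Pt eqxx.
rewrite big_mkcond (bigD1_seq (f t)) ?undup_uniq //= inE Pt eqxx (mem_set (fD _ Pt)).
rewrite big1 ?addr0 // => i.
by rewrite eq_sym => /negPf fi; rewrite inE fi !andbF.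
Qed.
End FiberSums.

Section CountFiber.
Variables (k : finFieldType) (V : finType) (Q : quiver V) (M N : qmod k Q).

(** Each cocycle is a unique sum of a chosen representative and a coboundary. *)
Lemma sum_Z1 (L : nmodType) (F : cochain M N -> L) :
    (forall c b, c \in ext_cochains M N -> b \in B1 M N -> F (c + b) = F c) ->
  \sum_(xi in Z1 M N) F xi =
  (\sum_(c in ext_cochains M N) F c) *+ #|k| ^ \dim (B1 M N).
Proof.
move=> FE; pose C := ext_cochains M N; pose B := B1 M N.
pose A := [predX C & B].
pose s (x : cochain M N * cochain M N) := x.1 + x.2.
have s_inj : {in A &, injective s}.
  move=> [c b] [c' b'] /andP[/= cC bB] /andP[/= cC' bB'] e.
  have E : c - c' = b' - b.
    by rewrite -[c](addrK b) -[c + b]/(s (c, b)) e /s /= addrAC [c' + b']addrC addrK.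
  have : c - c' \in (C :&: B)%VS by rewrite memv_cap memvB //= E memvB.
  rewrite capv_diff memv0 subr_eq0 => /eqP cc; congr pair => //.
  by move: e; rewrite /s /= cc => /addrI.
transitivity (\sum_(xi in s @: A) F xi).
  apply: eq_bigl => xi; apply/idP/imsetP => [/Z1_decomp[c cC [b bB ->]]|].
    by exists (c, b) => //; apply/andP.
  case=> -[c b] /andP[/= cC bB] ->.
  by apply: memvD; [apply: ext_cochains_Z1|apply: (subvP (B1_sub_Z1 M N))].
rewrite big_imset //=.
rewrite -(pair_big_dep (mem C) (fun _ => mem B) (fun c b => F (c + b))) /=.
rewrite -sumrMnl; apply: eq_bigr => c cC.
by rewrite -card_vspace -sumr_const; apply: eq_bigr => b bB; apply: FE.
Qed.

Definition submods_over xi (T : {vspace N}) (U : {vspace M}) :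
    pred {vspace (N * M)%type} :=
  fun W => [&& `[< @is_submod _ _ _ (twist xi) W >], sub_part W == T & quo_part W == U].

Section Fiber.
Variables (U : {vspace M}) (T : {vspace N}) (p : 'End(N)) (r : 'End(M)).
Hypotheses (sU : is_submod U) (sT : is_submod T).
Hypotheses (gp : graded_proj p) (gr : graded_proj r).
Hypotheses (kp : lker p = T) (lr : limg r = U).

Lemma arrow_proj_img : (arrow_proj p r @: Z1 M N)%VS = C1 p r.
Proof.
apply/vspaceP => xi; apply/idP/idP => [|/(C1P gp gr) <-].
  by apply/subvP/limgS/subvf.
rewrite -(arrow_projK gp gr) memv_img // arrow_proj_Z1 //.
Qed.

(** The pairs (xi, W) over (T, U) correspond to the pairs (w, h) with
    xi = w + delta h and W the graph of h, where p w r = 0 and h is arbitrary.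
    The number of such w is the quotient of the numbers of cochains on (M, N)
    and on (U, N / T); the identity is stated without division. *)
Lemma card_over :
  ((\sum_(xi in Z1 M N) #|submods_over xi T U|) *
    #|k| ^ (\sum_(a : arrow Q) \dim (idem M (tgt a) @: U) *
                             \dim (idem N (src a) @: limg p)) =
  #|k| ^ (\sum_i \dim (idem M i @: U) * \dim (idem N i @: limg p)) *
  #|k| ^ \dim (Z1 M N))%N.
Proof.
pose K := (Z1 M N :&: lker (arrow_proj p r))%VS.
pose A := [predX K & C0 p r].
pose s (x : cochain M N * 'Hom(M, N)) := (x.1 + delta M N x.2, graph_sub p r x.2).
have C0_sub h : h \in C0 p r -> h \in C0 \1%VF \1%VF.
  by move=> /(C0P gp gr)[h1 _]; apply/C0_1P.
have s_inj : {in A &, injective s}.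
  move=> [w h] [w' h'] /andP[/= _ hC] /andP[/= _ hC'] e.
  have /= e1 := congr1 fst e; have /= e2 := congr1 snd e.
  have hh : h = h' by apply: (graph_sub_inj gp gr kp lr hC hC'); exact: e2.


  by congr pair => //; apply: (addIr (delta M N h)); rewrite e1 hh.
have -> : (\sum_(xi in Z1 M N) #|submods_over xi T U|)%N = #|s @: A|.
  rewrite -sum1_card; under eq_bigr do rewrite -sum1_card.
  rewrite pair_big_dep /=; apply: eq_bigl => -[xi W] /=.
  apply/andP/imsetP => [[Zxi /and3P[/asboolP sW /eqP subW /eqP quoW]]|].
    have iW i (x : N * M) : x \in W -> (idem N i x.1, idem M i x.2) \in W.
      case/(@is_submodP _ _ _ (twist xi)): sW => + _ => /(_ i x).
      by rewrite twist_idemE.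
    have [h hC WE] := graph_sub_surj gp gr kp lr iW quoW subW.
    exists (xi - delta M N h, h); last by rewrite /s /= subrK WE.
    rewrite WE in sW; apply/andP; split=> //=; rewrite memv_cap.
    rewrite memvB ?delta_Z1 ?C0_sub //=.
    exact/(graph_sub_submod sU sT gp gr kp lr Zxi hC).
  case=> -[w h] /andP[/= wK hC] [-> ->].
  move: wK; rewrite memv_cap => /andP[Zw kw].
  have Zxi : w + delta M N h \in Z1 M N by rewrite memvD ?delta_Z1 ?C0_sub.
  split=> //; apply/and3P; split.
  - apply/asboolP/(graph_sub_submod sU sT gp gr kp lr Zxi hC).
    by rewrite addrK.
  - by rewrite (sub_part_graph gr kp lr).
  - by rewrite (quo_part_graph gr kp lr).
rewrite card_in_imset // cardX card_vspace card_C0 // lr mulnAC mulnC.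
congr (_ * _)%N; rewrite -expnD -(limg_ker_dim (arrow_proj p r) (Z1 M N)).
by rewrite arrow_proj_img dim_C1 // lr.
Qed.
End Fiber.
End CountFiber.

(** * The quantum torus and its exponents *)

Section Vpow.
Variables (q : nat) (v : algC) (q_gt0 : (0 < q)%N) (hv : v ^+ 2 = q%:R).

Lemma v_neq0 : v != 0.
Proof.
have : v ^+ 2 != 0 by rewrite hv pnatr_eq0 -lt0n.
by rewrite expf_eq0.
Qed.

Lemma vpowD a b : vpow v (a + b) = vpow v a * vpow v b.
Proof. by apply: val_inj; rewrite /= expfzDr // v_neq0. Qed.

Lemma vpow0 : vpow v 0 = 1.
Proof. exact: val_inj. Qed.

Lemma vpow_nat j : vpow v (2 * j)%N%:Z = (q ^ j)%:R.
Proof.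
apply: val_inj; rewrite [RHS](rmorph_nat \val) /= natrX -hv -exprM.
by [].
Qed.
End Vpow.

Section TorusBilinear.
Variables (v : algC) (m : nat) (Lam : 'M[int]_m).
Local Notation T := (torus v m).

(** The linear extension to the torus of a function on exponents: multiplication
    in the torus is obtained from it by extending in each argument, which makes
    its bilinearity immediate. *)
Definition lin_ext (G : 'cV[int]_m -> T) (x : T) : T :=
  \sum_(e <- msupp x) x@_e *: G e.

Lemma lin_extEw G x (d : {fset 'cV[int]_m}) : (msupp x `<=` d)%fset ->
  lin_ext G x = \sum_(e <- d) x@_e *: G e.
Proof.
move=> xd; rewrite /lin_ext (big_fset_incl _ xd) //= => e _ /mcoeff_outdom ->.
by rewrite scale0r.
Qed.

Lemma lin_extD G x y : lin_ext G (x + y) = lin_ext G x + lin_ext G y.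
Proof.
rewrite !(@lin_extEw _ _ (msupp x `|` msupp y)%fset);
  rewrite ?fsubsetUl ?fsubsetUr ?msuppD_le //.
by rewrite -big_split; apply: eq_bigr => e _; rewrite mcoeffD scalerDl.
Qed.

Lemma lin_ext0 G : lin_ext G 0 = 0.
Proof. by rewrite /lin_ext msupp0 big_seq_fset0. Qed.

Lemma lin_ext_sum G (I : finType) (P : pred I) (a : I -> Zv v) (e : I -> 'cV[int]_m) :
  lin_ext G (\sum_(i | P i) a i *: << e i >>) = \sum_(i | P i) a i *: G (e i).
Proof.
rewrite (big_morph _ (lin_extD G) (lin_ext0 G)); apply: eq_bigr => i _.
rewrite (@lin_extEw _ _ [fset (e i)]%fset); last first.
  by apply: fsubset_trans (msuppZ_le _ _) msuppU_le.
by rewrite big_seq_fset1 mcoeffZ mcoeffU eqxx mulr1.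
Qed.

Lemma torus_mulE x y : torus_mul Lam x y =
  lin_ext (fun e => lin_ext (fun f => vpow v (lam_form Lam e f) *: << e + f >>) y) x.
Proof.
apply: eq_bigr => e _; rewrite scaler_sumr; apply: eq_bigr => f _.
by rewrite !scalerA.
Qed.

Lemma torus_mul_sum (I J : finType) (P : pred I) (R : pred J)
    (a : I -> Zv v) (b : J -> Zv v) (e : I -> 'cV[int]_m) (f : J -> 'cV[int]_m) :
  torus_mul Lam (\sum_(i | P i) a i *: << e i >>) (\sum_(j | R j) b j *: << f j >>) =
  \sum_(i | P i) \sum_(j | R j)
    (a i * b j * vpow v (lam_form Lam (e i) (f j))) *: << e i + f j >>.
Proof.
rewrite torus_mulE lin_ext_sum; apply: eq_bigr => i _.
rewrite lin_ext_sum scaler_sumr; apply: eq_bigr => j _.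
by rewrite !scalerA.
Qed.
End TorusBilinear.

Lemma euler_formE (k : finFieldType) (n : nat) (Q : quiver 'I_n)
    (e f : 'cV[int]_n) : euler_form k Q e f =
  \sum_i e i 0 * f i 0 - \sum_(a : arrow Q) e (tgt a) 0 * f (src a) 0.
Proof.
rewrite /euler_form; under eq_bigr do under eq_bigr do rewrite euler_simple mulrBr.
under eq_bigr do rewrite big_split /=.
rewrite big_split /=; congr (_ + _).
  apply: eq_bigr => i _; rewrite (bigD1 i) //= eqxx mulr1 big1 ?addr0 // => j.
  by rewrite eq_sym => /negPf ->; rewrite mulr0.
under eq_bigr do rewrite sumrN; rewrite sumrN; congr (- _).
transitivity (\sum_i \sum_j
    \sum_(a : arrow Q | (src a == j) && (tgt a == i)) e i 0 * f j 0).
  apply: eq_bigr => i _; apply: eq_bigr => j _; rewrite sumr_const -natz mulr_natr.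
  by congr (_ *+ _); apply: eq_card => a; rewrite inE.
rewrite pair_big (exchange_big_dep xpredT) //=; apply: eq_bigr => a _.
rewrite (big_pred1 (tgt a, src a)) // => -[i j] /=.
by rewrite [RHS]xpair_eqE andbC eq_sym; congr (_ && _); rewrite eq_sym.
Qed.

Section FormIdentities.
Variables (k : finFieldType) (m n : nat) (le_nm : (n <= m)%N) (Qt : quiver 'I_m).
Local Notation Q := (full_subquiver n Qt).
Local Notation widen := (widen_ord le_nm).
Local Notation I := (Itilde m n).
Local Notation R := (Rtilde k le_nm Qt).
Local Notation B := (Btilde le_nm Qt).

Lemma card_sub_arrows (i j : 'I_n) :
  #|arrows_between Q i j| = #|arrows_between Qt (widen i) (widen j)|.
Proof.
rewrite -(card_imset _ val_inj); apply: eq_card => a.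
apply/imsetP/idP => [[b]|].
  rewrite !inE => /andP[/eqP e1 /eqP e2] ->.
  by rewrite -!val_eqE /= -e1 -e2 !eqxx.
rewrite inE -!val_eqE /= => /andP[/eqP e1 /eqP e2].
have h : ((src a < n) && (tgt a < n))%N by rewrite e1 e2 !ltn_ord.
by exists (Sub a h) => //; rewrite inE -!val_eqE /= e1 e2 !eqxx.
Qed.

Lemma Itilde_widen (i : 'I_m) (j : 'I_n) : I i j = (i == widen j)%:R.
Proof.
rewrite mxE -val_eqE /=; case: eqP => // ->.
by rewrite ltn_ord.
Qed.

Lemma Itilde_top p (A : 'M[int]_(m, p)) i j : (I^T *m A) i j = A (widen i) j.
Proof.
rewrite mxE (bigD1 (widen i)) //= mxE Itilde_widen eqxx mul1r.
by rewrite big1 ?addr0 // => l /negPf li; rewrite mxE Itilde_widen li mul0r.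
Qed.

Lemma euler_form_mx (e f : 'cV[int]_n) :
  euler_form k Q e f = (e^T *m (I^T *m (I - R)) *m f) 0 0.
Proof.
rewrite -mulmxA mxE; apply: eq_bigr => i _; rewrite !mxE mulr_sumr.
apply: eq_bigr => j _; rewrite euler_simple Itilde_top !mxE.
rewrite ext1_dim_simple card_sub_arrows -mulrA.
congr (_ * _); rewrite mulrC; congr ((_ - _) * _).
by rewrite natz /= ltn_ord andbT -val_eqE.
Qed.

(** Counting arrows with sign is antisymmetrising the count of arrows, and the
    identity matrix cancels. *)
Lemma Btilde_top : I^T *m B = I^T *m (I - R) - (I^T *m (I - R))^T.
Proof.
apply/matrixP => i j.
have sub_tr (A : 'M[int]_n) : (A - A^T) i j = A i j - A j i by rewrite !mxE.
rewrite sub_tr !Itilde_top !mxE !ext1_dim_simple /= !ltn_ord !andbT eq_sym.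
by ring.
Qed.

Section Lam.
Variables (Lam : 'M[int]_m) (Lam_antisym : Lam^T = - Lam).
Hypothesis Lam_compat : Lam *m (- B) = I.
Local Notation lam := (lam_form Lam).
Local Notation "<[ e , f ]>" := (euler_form k Q e f).

Lemma mx11_tr (x : 'M[int]_1) : x^T 0 0 = x 0 0.
Proof. by rewrite mxE. Qed.

Lemma lamC a b : lam a b = - lam b a.
Proof.
rewrite /lam_form -mx11_tr !trmx_mul Lam_antisym trmxK.
by rewrite mulNmx mulmxN mulmxA [LHS]mxE.
Qed.

Lemma lamBl a b c : lam (a - b) c = lam a c - lam b c.
Proof. by rewrite /lam_form linearB /= !mulmxBl mxE [X in _ + X]mxE. Qed.

Lemma lamBr a b c : lam c (a - b) = lam c a - lam c b.
Proof. by rewrite lamC lamBl opprB addrC -lamC lamC opprK. Qed.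

(** Compatibility makes Lambda read off coordinates against the columns of the
    exchange matrix. *)
Lemma lam_Br x e : lam x (B *m e) = - (x^T *m I *m e) 0 0.
Proof.
rewrite /lam_form mulmxA -(mulmxA _ Lam) -[B]opprK mulmxN Lam_compat.
by rewrite mulmxN mulNmx mxE.
Qed.

Lemma lam_B_A e n' : lam (B *m e) ((I - R) *m n') = <[e, n']>.
Proof.
rewrite lamC lam_Br opprK -mx11_tr euler_form_mx.
by rewrite !trmx_mul !trmxK !mulmxA.
Qed.

Lemma lam_B_B f e : lam (B *m f) (B *m e) = <[f, e]> - <[e, f]>.
Proof.
rewrite lamC lam_Br opprK -mx11_tr !trmx_mul !trmxK !mulmxA.
rewrite -(mulmxA _ I^T) Btilde_top mulmxBr mulmxBl.
have sub00 (x y : 'M[int]_1) : (x - y) 0 0 = x 0 0 - y 0 0 by rewrite !mxE.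
rewrite sub00 -euler_form_mx -(mx11_tr (_ *m _^T *m _)).
by rewrite !euler_form_mx !trmx_mul !trmxK !mulmxA.
Qed.

Lemma euler_formDl a b c : <[a + b, c]> = <[a, c]> + <[b, c]>.
Proof. by rewrite !euler_form_mx linearD /= !mulmxDl mxE. Qed.

Lemma euler_formNr a c : <[c, - a]> = - <[c, a]>.
Proof. by rewrite !euler_form_mx mulmxN mxE. Qed.

Lemma euler_formDr a b c : <[c, a + b]> = <[c, a]> + <[c, b]>.
Proof. by rewrite !euler_form_mx !mulmxDr mxE. Qed.

(** On the left is the exponent of a term of the product in the torus. On the
    right, the second summand comes from the number of submodules over a pair
    (T, U) and the third from the weight of such a submodule, where f and e are
    the dimension vectors of T and U. *)
Lemma exponent_identity (f n' e m' : 'cV[int]_n) :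
  - <[f, n' - f]> - <[e, m' - e]> +
    lam (B *m f - (I - R) *m n') (B *m e - (I - R) *m m') =
  - lam ((I - R) *m m') ((I - R) *m n') + <[e, n' - f]> *+ 2
    - <[f + e, n' + m' - (f + e)]>.
Proof.
rewrite !(lamBl, lamBr) lam_B_B lam_B_A [lam _ (B *m e)]lamC lam_B_A.
rewrite [lam ((I - R) *m n') _]lamC !(euler_formDl, euler_formDr, euler_formNr, opprD).
by ring.
Qed.
End Lam.
End FormIdentities.

(** * The Caldero-Chapoton map *)

Section CC.
Variables (k : finFieldType) (v : algC) (m n : nat) (le_nm : (n <= m)%N).
Variable Qt : quiver 'I_m.
Hypothesis hv : v ^+ 2 = #|k|%:R.
Local Notation Q := (full_subquiver n Qt).
Local Notation A := (Itilde m n - Rtilde k le_nm Qt).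
Local Notation B := (Btilde le_nm Qt).
Implicit Types M N : qmod k Q.

Definition cc_term (d e : 'cV[int]_n) : torus v m :=
  vpow v (- euler_form k Q e (d - e)) *: << B *m e - A *m d >>.

(** The number of submodules of dimension vector e is absorbed by summing over the
    submodules themselves. *)
Lemma X_CC_sum M : X_CC le_nm v M =
  \sum_(U : {vspace M} | `[< is_submod U >]) cc_term (dimvec M) (sub_dimvec U).
Proof.
rewrite /X_CC -(@fsbig_fibers _ _ _ _ [set: 'cV[int]_n] (@sub_dimvec _ _ _ M)) //.
apply: eq_fsbigr => e _; rewrite card_fset_set_fin -scalerA scaler_nat.
congr (_ *+ _); apply: eq_card => U; rewrite !inE.
by apply/idP/andP => [/set_mem[sU <-]|[/asboolP sU /eqP <-]];
  [split=> //; apply/asboolP|apply/mem_set].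
Qed.

Lemma isomorphic_dim M N (f : 'Hom(M, N)) (U : {vspace M}) :
  is_hom f -> lker f == 0%VS -> sub_dimvec (f @: U)%VS = sub_dimvec U.
Proof.
move=> hf f0; apply/matrixP => i j; rewrite !mxE -limg_comp -(hf.1 i) limg_comp.
by rewrite limg_dim_eq // (eqP f0) capv0.
Qed.

Lemma limg_submod M N (f : 'Hom(M, N)) (U : {vspace M}) :
  is_hom f -> is_submod U -> is_submod (f @: U)%VS.
Proof.
move=> [hi ha] [ui ua]; split=> [i|a].
  by rewrite -limg_comp -hi limg_comp limgS.
by rewrite -limg_comp -ha limg_comp limgS.
Qed.

Lemma X_CC_iso M N : isomorphic M N -> X_CC le_nm v M = X_CC le_nm v N.
Proof.
case=> f [g [hf hg gf fg]].
have fgK (U : {vspace N}) : (f @: (g @: U))%VS = U by rewrite -limg_comp fg lim1g.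
have gfK (U : {vspace M}) : (g @: (f @: U))%VS = U by rewrite -limg_comp gf lim1g.
have f0 : lker f == 0%VS.
  by apply/lker0P/(can_inj (g := g)) => x; rewrite -comp_lfunE gf id_lfunE.
have ff : (f @: fullv)%VS = fullv.
  by apply/eqP; rewrite eqEsubv subvf -{1}(fgK fullv) limgS ?subvf.
rewrite !X_CC_sum /dimvec -ff (isomorphic_dim _ hf f0).
rewrite [RHS](reindex (fun U : {vspace M} => f @: U)%VS) /=; last first.
  by exists (fun U : {vspace N} => g @: U)%VS => U _.
apply: eq_big => [U|U _]; last by rewrite (isomorphic_dim _ hf f0).
apply/asboolP/asboolP => [|h]; first exact: limg_submod.
by rewrite -(gfK U); apply: limg_submod.
Qed.

Lemma iso_repr_iso (E : std_mod k Q) : isomorphic (std_qmod E) (std_qmod (iso_repr E)).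
Proof.
apply: (@xgetI _ E [set F | isomorphic (std_qmod E) (std_qmod F)]%classic E).
exact: isomorphic_refl.
Qed.

(** The representative is chosen from the isomorphism class, viewed as a set;
    isomorphic modules have equal classes, hence equal representatives. *)
Lemma iso_classes_uniq (E F : std_mod k Q) :
  iso_classes E -> iso_classes F -> isomorphic (std_qmod E) (std_qmod F) -> E = F.
Proof.
move=> [G _ <-] [H _ <-] e.
have GH : isomorphic (std_qmod G) (std_qmod H).
  exact: (isomorphic_trans (isomorphic_trans (iso_repr_iso G) e)
    (isomorphic_sym (iso_repr_iso H))).
have S : [set F | isomorphic (std_qmod G) (std_qmod F)]%classic =
         [set F | isomorphic (std_qmod H) (std_qmod F)]%classic.
  apply/seteqP; split=> K /=; apply: isomorphic_trans => //.
  exact: isomorphic_sym.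
rewrite /iso_repr S.
have : [set F | isomorphic (std_qmod H) (std_qmod F)]%classic H.
  exact: isomorphic_refl.
move: [set F | isomorphic (std_qmod H) (std_qmod F)]%classic => S' S'H.
rewrite /xget; case: pselect => // h; case: h.
by exists H; apply/asboolP.
Qed.

Lemma iso_classesP M : exists E, iso_classes E /\ isomorphic M (std_qmod E).
Proof.
have [E ME] := std_modP M; exists (iso_repr E); split; first by exists E.
exact: isomorphic_trans ME (iso_repr_iso E).
Qed.

(** Each representative cochain contributes to exactly one isomorphism class, that
    of the middle term of its extension. *)
Lemma sum_iso_classes M N :
  \sum_(E \in @iso_classes k 'I_n Q)
      (eps M N (std_qmod E))%:R *: X_CC le_nm v (std_qmod E) =
  \sum_(c in ext_cochains M N) X_CC le_nm v (twist c).
Proof.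
have [rep repP] := choice (fun c : cochain M N => iso_classesP (twist c)).
have rep1 c : iso_classes (rep c) by case: (repP c).
have rep2 c : isomorphic (twist c) (std_qmod (rep c)) by case: (repP c).
under [RHS]eq_bigr => c _ do rewrite (X_CC_iso (rep2 c)).
rewrite -(@fsbig_fibers _ _ _ _ (@iso_classes k 'I_n Q) rep
   (fun E => X_CC le_nm v (std_qmod E))) //.
apply: eq_fsbigr => E /set_mem EC; rewrite scaler_nat epsE; congr (_ *+ _).
apply: eq_card => c; rewrite !inE /ext_iso; congr (_ && _).
apply/asboolP/eqP => [cE|<-] //; apply: iso_classes_uniq => //.
exact: (isomorphic_trans (isomorphic_sym (rep2 c)) cE).
Qed.

Section Product.
Variables M N : qmod k Q.

Lemma sub_dimvec_twist (xi : cochain M N) (W : {vspace twist xi}) :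
  xi \in Z1 M N -> is_submod W ->
  sub_dimvec W = sub_dimvec (sub_part W) + sub_dimvec (quo_part W).
Proof.
move=> Zxi sW; apply/matrixP => i j; rewrite !mxE.
by rewrite (dim_idem_parts Zxi sW) PoszD.
Qed.

Lemma dimvec_twist (xi : cochain M N) :
  xi \in Z1 M N -> dimvec (twist xi) = dimvec N + dimvec M.
Proof.
move=> Zxi; rewrite /dimvec sub_dimvec_twist //; last by split=> *; apply: subvf.
have -> : sub_part (fullv : {vspace twist xi}) = fullv.
  by apply/vspaceP => x; rewrite sub_partP !memvf.
suff -> : quo_part (fullv : {vspace twist xi}) = fullv by [].
by apply/vspaceP => x; rewrite memvf; apply/quo_partP; exists 0; rewrite memvf.
Qed.

(** The term of a submodule W depends only on its trace T and image U, so it is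
    enough to count the submodules of each extension over each pair (T, U). *)
Lemma sum_X_CC_twist :
  \sum_(xi in Z1 M N) X_CC le_nm v (twist xi) =
  \sum_(T : {vspace N} | `[< is_submod T >])
    \sum_(U : {vspace M} | `[< is_submod U >])
      cc_term (dimvec N + dimvec M) (sub_dimvec T + sub_dimvec U)
        *+ (\sum_(xi in Z1 M N) #|submods_over xi T U|)%N.
Proof.
pose g (x : {vspace N} * {vspace M}) :=
  cc_term (dimvec N + dimvec M) (sub_dimvec x.1 + sub_dimvec x.2).
under [RHS]eq_bigr => T _ do under eq_bigr => U _ do rewrite -sumrMnr.
rewrite pair_big /= [RHS]exchange_big /=; apply: eq_bigr => xi Zxi.
rewrite X_CC_sum dimvec_twist //.
rewrite (partition_big (fun W : {vspace (N * M)%type} => (sub_part W, quo_part W))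
  (fun x => `[< is_submod x.1 >] && `[< is_submod x.2 >])) /=; last first.
  move=> W /asboolP sW; apply/andP; split; apply/asboolP.
    exact: sub_part_submod sW.
  exact: quo_part_submod sW.
apply: eq_bigr => -[T U] _ /=.
transitivity (\sum_(W in @submods_over _ _ Q M N xi T U) g (T, U)); last first.
  by rewrite sumr_const.
apply: eq_big => [W|W]; first by rewrite [RHS]unfold_in /submods_over xpair_eqE.
move=> /andP[/asboolP sW /eqP[<- <-]].
by rewrite sub_dimvec_twist.
Qed.

Lemma card_over_euler (T : {vspace N}) (U : {vspace M}) :
  is_submod T -> is_submod U ->
  (\sum_(xi in Z1 M N) #|submods_over xi T U|)%N%:R =
  vpow v ((2 * \dim (Z1 M N))%N%:Z +
          euler_form k Q (sub_dimvec U) (dimvec N - sub_dimvec T) *+ 2).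
Proof.
move=> sT sU.
have [r gr lr] := graded_proj_onto sU.1.
have [p0 gp0 lp0] := graded_proj_onto sT.1.
have gp := graded_projC gp0.
have kp : lker (\1 - p0)%VF = T.
  apply/vspaceP => x; rewrite memv_ker add_lfunE opp_lfunE id_lfunE subr_eq0 -lp0.
  apply/eqP/memv_imgP => [e|[y _ ->]]; first by exists x; rewrite ?memvf.
  by rewrite gp0.1.
have q0 : (0 < #|k|)%N by rewrite (ltn_trans _ (finNzRing_gt1 k)).
have := card_over sU sT gp gr kp lr.
set e1 := (\sum_(a : arrow Q) _)%N; set e0 := (\sum_i _)%N => H.
have eE : euler_form k Q (sub_dimvec U) (dimvec N - sub_dimvec T) = e0%:Z - e1%:Z.
  have dE i : (dimvec N - sub_dimvec T) i 0 = (\dim (idem N i @: limg (\1 - p0)%VF))%:Z.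
    rewrite !mxE (dim_idem_proj i gp) kp PoszD addrC addKr.
    by [].
  rewrite euler_formE /e0 /e1 -!natz !natr_sum; congr (_ - _).
    by apply: eq_bigr => i _; rewrite dE !mxE natrM !natz.
  by apply: eq_bigr => a _; rewrite dE !mxE natrM !natz.
have := congr1 (fun j => j%:R : Zv v) H; rewrite !natrM -!(vpow_nat hv) => H'.
have V : vpow v (2 * e1)%N%:Z * vpow v (- (2 * e1)%N%:Z) = 1.
  by rewrite -(vpowD q0 hv) subrr vpow0.
rewrite -[LHS]mulr1 -[X in _ * X = _]V mulrA H'.
rewrite -!(vpowD q0 hv) eE; congr vpow; rewrite !PoszM.
by ring.
Qed.
End Product.
End CC.

(** * The multiplication formula *)

Local Open Scope classical_set_scope.
Local Open Scope ring_scope.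

(** Cochains that differ by a coboundary give isomorphic modules, so each class
    contributes as many equal terms as there are coboundaries. *)
Lemma X_CC_cohomologous (k : finFieldType) (v : algC) (m n : nat) (le_nm : (n <= m)%N)
    (Qt : quiver 'I_m) (M N : qmod k (full_subquiver n Qt)) :
  (\sum_(c in ext_cochains M N) X_CC le_nm v (twist c)) *+ #|k| ^ \dim (B1 M N) =
  \sum_(xi in Z1 M N) X_CC le_nm v (twist xi).
Proof.
apply/esym/(sum_Z1 (F := fun xi => X_CC le_nm v (twist xi))) => c b cC bB.
apply: X_CC_iso.
have Zc := ext_cochains_Z1 cC.
have Zcb : c + b \in Z1 M N by apply: memvD => //; apply: (subvP (B1_sub_Z1 M N)).
apply: (@ses_equiv_iso _ _ _ M N (twist_ses (c + b)) (twist_ses c)).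
by apply/(twist_equivP Zcb Zc); rewrite addrAC subrr add0r.
Qed.

Lemma vpow_scaleK (q : nat) (v : algC) (m : nat) (q_gt0 : (0 < q)%N)
    (hv : v ^+ 2 = q%:R) (z : int) (x : torus v m) :
  vpow v (- z) *: (vpow v z *: x) = x.
Proof.
by rewrite scalerA -(vpowD q_gt0 hv) addNr vpow0; apply: scale1r.
Qed.

Lemma vpow_scaleI (q : nat) (v : algC) (m : nat) (q_gt0 : (0 < q)%N)
    (hv : v ^+ 2 = q%:R) (z : int) (x y : torus v m) :
  vpow v z *: x = vpow v z *: y -> x = y.
Proof.
move=> e; rewrite -[x](vpow_scaleK q_gt0 hv z) e.
exact: vpow_scaleK q_gt0 hv z y.
Qed.

Lemma scale_eq (R : comPzRingType) (L : lmodType R) (a b c d e : R) (x y : L) :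
  a * b = c * (d * e) -> x = y -> a *: (b *: x) = c *: (d *: (e *: y)).
Proof. by move=> E ->; rewrite !scalerA E mulrA. Qed.

Theorem theorem3p3 (k : finFieldType) (v : algC) (hv : v ^+ 2 = #|k|%:R)
    (m n : nat) (n_gt0 : (0 < n)%N) (le_nm : (n <= m)%N)
    (Qt : quiver 'I_m) (Qt_acyclic : acyclic Qt)
    (Lam : 'M[int]_m) (Lam_antisym : Lam^T = - Lam)
    (Lam_compat : Lam *m (- Btilde le_nm Qt) = Itilde m n)
    (M N : qmod k (full_subquiver n Qt)) :
  (#|k| ^ ext1_dim M N)%:R *:
    torus_mul Lam (X_CC le_nm v N) (X_CC le_nm v M) =
  vpow v (- lam_form Lam ((Itilde m n - Rtilde k le_nm Qt) *m dimvec M)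
                         ((Itilde m n - Rtilde k le_nm Qt) *m dimvec N)) *:
    \sum_(E \in @iso_classes k 'I_n (full_subquiver n Qt))
      (eps M N (std_qmod E))%:R *: X_CC le_nm v (std_qmod E).
Proof.
have q0 : (0 < #|k|)%N by rewrite (ltn_trans _ (finNzRing_gt1 k)).
set b := (2 * \dim (B1 M N))%N%:Z.
(* Multiplying by the number of coboundaries, a power of v, is injective. *)
apply: (vpow_scaleI q0 hv (z := b)); rewrite sum_iso_classes.
rewrite [RHS]scalerA [X in _ = X *: _]mulrC -[RHS]scalerA [in RHS]/b (vpow_nat hv).
rewrite [X in _ = _ *: X]scaler_nat X_CC_cohomologous sum_X_CC_twist !X_CC_sum.
rewrite torus_mul_sum [LHS]scalerA [LHS]scaler_sumr [RHS]scaler_sumr.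
apply: eq_bigr => T /asboolP sT.
rewrite [LHS]scaler_sumr [RHS]scaler_sumr.
apply: eq_bigr => U /asboolP sU.
rewrite -[X in _ = _ *: X]scaler_nat (card_over_euler hv sT sU).
rewrite /cc_term; apply: scale_eq; last first.
  by congr << _ >>; rewrite !mulmxDr opprD addrACA.
rewrite -!(vpow_nat hv) -!(vpowD q0 hv); congr vpow.
rewrite (exponent_identity k Lam_antisym Lam_compat).
by rewrite dim_Z1 -ext1_dimE !PoszM PoszD; ring.
Qed.
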